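(* Let $A,B\in\mathbb M_n(\mathbb C)$ be positive semidefinite and let $f:[0,\infty)\to[0,\infty)$ be concave. Then there exist unitary matrices $U,V\in\mathbb M_n(\mathbb C)$ such that $$0\le f(A+B)-Uf(A)U^*\le Vf(B)V^*.$$
   Context: $\mathbb M_n(\mathbb C)$ is the algebra of complex $n\times n$ matrices. For Hermitian $S,T$, $S\le T$ means $T-S$ is positive semidefinite. For $T$ positive semidefinite, $f(T)$ is defined by the functional calculus (apply $f$ to the eigenvalues in a spectral decomposition). *)

(* Defs.v *)
From mathcomp Require Import all_boot all_order all_algebra.
From mathcomp Require Import complex.
From mathcomp Require Import boolp classical_sets reals interval_inference convex.

Set Implicit Arguments.
Unset Strict Implicit.
Unset Printing Implicit Defensive.

Import Order.TTheory GRing.Theory Num.Theory.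
Local Open Scope ring_scope.
Local Open Scope complex_scope.
Local Open Scope sesquilinear_scope.

(* The order of R[i] is partial: [0 <= z] says that z is real and nonnegative. *)
Definition psdmx (R : realType) (n : nat) (A : 'M[R[i]]_n) : Prop :=
  A \is hermsymmx /\
  forall u : 'cV[R[i]]_n, 0 <= (u ^t* *m A *m u) 0 0.

Definition loewner_le (R : realType) (n : nat) (S T : 'M[R[i]]_n) : Prop :=
  psdmx (T - S).

(* On normal matrices, A = P^* diag(d) P with P := spectralmx A unitary and
   d := spectral_diag A. If A is positive semidefinite then d is real and
   nonnegative, so only the values of f on [0, +oo) matter. *)
Definition fun_calc (R : realType) (n : nat) (f : R -> R) (A : 'M[R[i]]_n) :
    'M[R[i]]_n :=
  (spectralmx A) ^t* *m
  diag_mx (map_mx (fun z : R[i] => (f (complex.Re z))%:C) (spectral_diag A)) *m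
  spectralmx A.

Definition concave_function (R : realType) (D : set R) (f : R -> R) : Prop :=
  @convex_function R R^o D (fun x => - f x).

Lemma concave_functionP (R : realType) (D : set R) (f : R -> R) :
  concave_function D f <->
  forall x y t : R, D x -> D y -> 0 <= t <= 1 ->
    t * f x + (1 - t) * f y <= f (t * x + (1 - t) * y).
Proof.
split=> [cf x y t Dx Dy /andP[t0 t1]|cf t x y].
  by have := cf (Itv01 t0 t1) x y (mem_set Dx) (mem_set Dy); rewrite -convN lerN2.
rewrite !inE => Dx Dy; rewrite -convN lerN2; apply: cf => //.
by apply/andP; split.
Qed.

(* The functional calculus does not depend on the spectral decomposition. *)
Lemma fun_calcE (R : realType) (n : nat) (f : R -> R) (P : 'M[R[i]]_n)
    (d : 'rV[R]_n) :
  P \is unitarymx ->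
  fun_calc f (P ^t* *m diag_mx (map_mx (real_complex R) d) *m P) =
  P ^t* *m diag_mx (map_mx (fun x => (f x)%:C) d) *m P.
Proof.
move=> PU; set A := P ^t* *m _ *m P.
have PPt : P *m P ^t* = 1%:M by apply/unitarymxP.
have PtP : P ^t* *m P = 1%:M by apply: mulmx1C.
have AN : A \is normalmx.
  have AH : A \is hermsymmx.
    apply/is_hermitianmxP; rewrite expr0 scale1r /A.
    rewrite !trmx_mul !map_mxM map_trmx trmxK -map_mx_comp.
    rewrite (map_mx_id (@conjCK _)) tr_diag_mx map_diag_mx mulmxA.
    congr (_ *m diag_mx _ *m _); apply/rowP => i; rewrite !mxE.
    by rewrite -[RHS]/(conjc _) /= oppr0.
  exact: hermitian_normalmx AH.
rewrite /fun_calc; set Q := spectralmx A; set e := spectral_diag A.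
have QU : Q \is unitarymx by apply: spectral_unitarymx.
have QQt : Q *m Q ^t* = 1%:M by apply/unitarymxP.
have QtQ : Q ^t* *m Q = 1%:M by apply: mulmx1C.
have AE : A = Q ^t* *m diag_mx e *m Q.
  by rewrite -invmx_unitary //; apply/orthomx_spectralP.
set W := Q *m P ^t*.
have WE : W *m diag_mx (map_mx (real_complex R) d) = diag_mx e *m W.
  have : Q *m A *m P ^t* = diag_mx e *m W.
    by rewrite AE /W !mulmxA QQt mul1mx.
  by rewrite /A /W !mulmxA => <-; rewrite -[RHS]mulmxA PPt mulmx1.
set fe := map_mx _ e; set fd := map_mx _ d.
have WF : W *m diag_mx fd = diag_mx fe *m W.
  apply/matrixP => i j; rewrite mul_mx_diag mul_diag_mx !mxE.
  have := congr1 (fun M : 'M__ => M i j) WE.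
  rewrite /= mul_mx_diag mul_diag_mx !mxE mulrC => /eqP.
  rewrite -subr_eq0 -mulrBl mulf_eq0 subr_eq0 => /orP[/eqP <-|/eqP W0].
    by rewrite /= mulrC.
  by rewrite W0 mul0r mulr0.
have -> : diag_mx fe = W *m diag_mx fd *m W ^t*.
  rewrite WF /W trmx_mul map_mxM map_trmx trmxK -map_mx_comp.
  rewrite (map_mx_id (@conjCK _)) -!mulmxA (mulmxA (P ^t*)) PtP mul1mx QQt.
  by rewrite mulmx1.
rewrite /W trmx_mul map_mxM map_trmx trmxK -map_mx_comp.
rewrite (map_mx_id (@conjCK _)) !mulmxA QtQ mul1mx -!mulmxA QtQ mulmx1.
by rewrite !mulmxA.
Qed.

(* Main.v *)
Require Import Defs.
From mathcomp Require Import all_boot all_order all_algebra.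
From mathcomp Require Import complex.
From mathcomp Require Import boolp classical_sets reals convex.
From mathcomp Require Import perm ring lra.

(* Replacing f by min(f - f(0), L t) with L large only shifts its values at the
   eigenvalues of A and A + B by f(0), so let f be Lipschitz with f(0) = 0. Deform
   the identity into f along phi_t = (1 - t) id + t f. Put S = A + B and let m(t) be
   the least squared Frobenius norm of
     E = phi_t(S) - U phi_t(A) U^* - V phi_t(C) V^*
   over unitaries U, V and diagonal C with 0 <= C <= diag(eigenvalues of B). Then
   m(0) = 0, and m(1) = 0 is the claim.
   At a minimum E commutes with both orbit terms X and Y, and the negative part of
   E annihilates Y. If w is concave with w(0) = 0, then the trace of
   w(X + Y) - w(X) - w(Y) on each positive eigenspace of E is at most 0 (Rotfel'd's
   inequality). Since d phi_t / dt = f - id is such a concave function of phi_t, the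
   minimum satisfies m' <= K m up to time 1 - eta; hence m = 0 on [0, 1) by a
   discrete Gronwall argument, and m(1) = 0 by letting eta tend to 0. *)

Set Implicit Arguments.
Unset Strict Implicit.
Unset Printing Implicit Defensive.

Import Order.TTheory GRing.Theory Num.Theory.
Local Open Scope ring_scope.
Local Open Scope complex_scope.
Local Open Scope sesquilinear_scope.

(** * A weighted form of Rotfel'd's trace inequality *)

(** The cap on C turns E = 0 at t = 1 into the claim: f(S) - U f(A) U^* is then V g(C) V^* with g =
    min(f - f(0), L t), and g(C) <= f(B) because a nonnegative concave function is nondecreasing. C
    must be free to shrink because a supergradient inequality weighted by a negative eigenvalue of E
    points the wrong way. Where E is negative, this freedom forces Y = 0; what remains is phi_t(s) -
    phi_t(a) = e, for which a Lipschitz bound suffices. On the positive part Rotfel'd's inequality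
    holds only up to an error, since phi_t(S) is X + Y + E and not X + Y. The error is at most K
    times an eigenvalue of E, and it is weighted by that eigenvalue, so it is quadratic in E, like m
    itself. The bound on m' comes from freezing the minimizer at t and using it as a competitor at t
    + h. The path stops at 1 - eta because phi_t has slope at least 1 - t: this makes it injective,
    so that commuting with phi_t(S) implies commuting with S, and it gives K = (L + 1) / eta, which
    blows up as eta tends to 0. *)

Lemma ler_normM (R : realType) (k K u : R) : `|k| <= K -> 0 <= u -> k * u <= K * u.
Proof. by move=> kK u0; apply: ler_wpM2r => //; apply: le_trans (ler_norm _) kK. Qed.

(* [k] is a supergradient at [phi a] of [w], seen as a concave function of [phi]. *)
Definition supergradients_wrt (R : realType) (K : R) (phi w : R -> R) :=
  forall a, 0 <= a -> exists2 k, `|k| <= K &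
    forall t, 0 <= t -> w t <= w a + k * (phi t - phi a).

Lemma supergradients_wrt_lip (R : realType) (K : R) (phi w : R -> R) x y :
  supergradients_wrt K phi w -> 0 <= x -> 0 <= y -> `|w x - w y| <= K * `|phi x - phi y|.
Proof.
move=> H x0 y0.
have main u v : 0 <= u -> 0 <= v -> w u - w v <= K * `|phi u - phi v|.
  move=> u0 v0; have [k kK /(_ u u0) ku] := H v v0.
  have : k * (phi u - phi v) <= K * `|phi u - phi v|.
    by apply: le_trans (ler_norm _) _; rewrite normrM; apply: ler_wpM2r.
  lra.
rewrite ler_norml; apply/andP; split; last exact: main.
by rewrite lerNl opprB distrC; apply: main.
Qed.

(** Average the supergradient inequality at [a] with the weights [p]. The missing mass 1 - sum p
    costs nothing, because the intercept [w a - k * phi a] is nonnegative: compare at 0, where [w]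
    and [phi] vanish. *)
Lemma weighted_jensen (R : realType) (n : nat) (K : R) (phi w : R -> R)
    (s z : 'I_n -> R) (p : 'I_n -> R) (a eps : R) :
  supergradients_wrt K phi w -> phi 0 = 0 -> w 0 = 0 -> 0 <= a -> 0 <= eps ->
  (forall j, 0 <= s j) -> (forall j, 0 <= p j) ->
  (forall j, p j != 0 -> phi (s j) = z j + eps) ->
  \sum_j p j * z j = phi a -> \sum_j p j <= 1 ->
  \sum_j p j * w (s j) <= w a + K * eps.
Proof.
move=> H phi0 w0 a0 e0 s0 p0 ps pz p1.
have [k kK Hk] := H a a0.
have c0 : 0 <= w a - k * phi a.
  by have := Hk 0 (lexx _); rewrite phi0 w0; lra.
have P0 : 0 <= \sum_j p j by apply: sumr_ge0.
have -> : w a + K * eps = (w a - k * phi a) + k * phi a + K * eps by lra.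
apply: (@le_trans _ _ (\sum_j p j * ((w a - k * phi a) + k * (z j + eps)))).
  apply: ler_sum => j _; have [->|pj] := eqVneq (p j) 0; first by rewrite !mul0r.
  by apply: ler_wpM2l => //; rewrite -ps //; have := Hk _ (s0 j); lra.
have -> : \sum_j p j * ((w a - k * phi a) + k * (z j + eps)) =
   (w a - k * phi a + k * eps) * (\sum_j p j) + k * \sum_j p j * z j.
  by rewrite !mulr_sumr -big_split /=; apply: eq_bigr => j _; ring.
rewrite pz mulrDl.
have : (w a - k * phi a) * (\sum_j p j) <= (w a - k * phi a) * 1 by apply: ler_wpM2l.
have : k * eps * (\sum_j p j) <= K * eps.
  have : K * eps * (\sum_j p j) <= K * eps * 1.
    by apply: ler_wpM2l => //; apply: mulr_ge0 => //; apply: le_trans (normr_ge0 k) kK.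
  have : k * eps * (\sum_j p j) <= K * eps * (\sum_j p j).
    by apply: ler_wpM2r => //; apply: ler_normM.
  lra.
lra.
Qed.

Definition bistochastic (R : realType) (n : nat) (al : 'I_n -> 'I_n -> R) :=
  [/\ forall i j, 0 <= al i j, forall i, \sum_j al i j = 1
    & forall j, \sum_i al i j = 1].

(** Stands in for a matching of two lists of eigenvalues. In use, [al i j] is the squared modulus of
    an entry of the unitary between two eigenbases of the same matrix. *)
Lemma bistochastic_sum (R : realType) (n : nat) (al : 'I_n -> 'I_n -> R)
    (e eA : 'I_n -> R) (g : R -> R) :
  bistochastic al -> (forall i j, al i j != 0 -> eA i = e j) ->
  \sum_i g (eA i) = \sum_j g (e j).
Proof.
move=> [_ r1 c1] ale.
transitivity (\sum_i \sum_j al i j * g (eA i)).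
  by apply: eq_bigr => i _; rewrite -mulr_suml r1 mul1r.
rewrite exchange_big; apply: eq_bigr => j _ /=.
transitivity (\sum_i al i j * g (e j)); last by rewrite -mulr_suml c1 mul1r.
apply: eq_bigr => i _; have [->|/ale ->//] := eqVneq (al i j) 0.
by rewrite !mul0r.
Qed.

(* For fixed [j] the weights [al i j * phi (a i) / z j] of the two families sum to 1,
   and for fixed [i] they sum to at most 1; where [z j = 0], the junk value [1 / 0 = 0]
   makes them vanish, as it should. *)
Lemma positive_part_ineq (R : realType) (n : nat) (K : R) (phi w : R -> R)
    (al : 'I_n -> 'I_n -> R) (s e a eA z : 'I_n -> R) :
  supergradients_wrt K phi w -> phi 0 = 0 -> w 0 = 0 ->
  (forall j, 0 <= s j) -> (forall i, 0 <= a i) -> (forall i, 0 <= phi (a i)) ->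
  bistochastic al -> (forall i j, al i j != 0 -> eA i = e j) ->
  (forall j, phi (s j) = z j + e j) -> (forall j, 0 <= z j) ->
  (forall i j, z j = 0 -> al i j * phi (a i) = 0) ->
  (forall i, phi (a i) * \sum_j al i j / z j <= 1) ->
  \sum_j Num.max (e j) 0 * ((\sum_i al i j * phi (a i)) / z j * w (s j)) <=
  \sum_i Num.max (eA i) 0 * w (a i) + K * \sum_j e j ^+ 2.
Proof.
move=> H phi0 w0 s0 a0 x0 [al0 r1 c1] ale ez z0 zal zq.
(* Once the error is written over [eA], the inequality can be proved for each [i] separately. *)
rewrite -(@bistochastic_sum _ _ al e eA (fun x => x ^+ 2)) //.
rewrite mulr_sumr -big_split /=.
rewrite (_ : \sum_j _ = \sum_i Num.max (eA i) 0 *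
    \sum_j al i j * phi (a i) / z j * w (s j)); last first.
  under [RHS]eq_bigr do rewrite mulr_sumr.
  rewrite exchange_big; apply: eq_bigr => j _ /=.
  rewrite mulr_suml mulr_suml mulr_sumr; apply: eq_bigr => i _.
  have [->|/ale ->//] := eqVneq (al i j) 0; by rewrite !(mul0r, mulr0).
apply: ler_sum => i _.
have K0 : 0 <= K by have [k kK _] := H 0 (lexx _); apply: le_trans kK.
have [ei|ei] := ltP 0 (eA i); last first.
  by rewrite !mul0r add0r; apply: mulr_ge0 => //; exact: sqr_ge0.
have -> : eA i * w (a i) + K * eA i ^+ 2 = eA i * (w (a i) + K * eA i) by ring.
apply: ler_wpM2l; first exact: ltW.
apply: (weighted_jensen (z := z) H) => //; first exact: ltW.
- by move=> j; apply: mulr_ge0; [apply: mulr_ge0|rewrite invr_ge0].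
- move=> j alj; rewrite ez; congr (_ + _); apply/esym/ale.
  by apply: contraNneq alj => ->; rewrite !mul0r.
- rewrite -[RHS]mul1r -(r1 i) mulr_suml; apply: eq_bigr => j _.
  have [zj|zj] := eqVneq (z j) 0; last by rewrite mulfVK.
  by rewrite zj mulr0 zal.
- apply: le_trans (zq i); rewrite mulr_sumr le_eqVlt; apply/orP; left; apply/eqP.
  by apply: eq_bigr => j _; ring.
Qed.

(** Split every weight into its positive and negative parts. The constant is 4 = 2 + 1 + 1: two uses
    of [positive_part_ineq], the indices with [z j = 0], and the negative part. *)
Lemma weighted_trace_ineq (R : realType) (n : nat) (K : R) (phi w : R -> R)
    (al be : 'I_n -> 'I_n -> R) (s e a eA b eB z : 'I_n -> R) :
  supergradients_wrt K phi w -> phi 0 = 0 -> w 0 = 0 -> (forall t, 0 <= t -> 0 <= phi t) ->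
  (forall j, 0 <= s j) -> (forall i, 0 <= a i) -> (forall k, 0 <= b k) ->
  bistochastic al -> (forall i j, al i j != 0 -> eA i = e j) ->
  bistochastic be -> (forall k j, be k j != 0 -> eB k = e j) ->
  (forall j, phi (s j) = z j + e j) ->
  (forall j, z j = \sum_i al i j * phi (a i) + \sum_k be k j * phi (b k)) ->
  (forall i, phi (a i) * \sum_j al i j / z j <= 1) ->
  (forall k, phi (b k) * \sum_j be k j / z j <= 1) ->
  (forall k, eB k < 0 -> b k = 0) ->
  (forall i j, e j < 0 -> al i j != 0 -> phi (a i) = z j) ->
  \sum_j e j * w (s j) - \sum_i eA i * w (a i) - \sum_k eB k * w (b k)
    <= 4 * K * \sum_j e j ^+ 2.
Proof.
move=> H phi0 w0 phi_ge0 s0 a0 b0 alB ale beB bee ez zE za zb eB0 neg.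
have [[al0 r1 c1] [be0 r2 c2]] := (alB, beB).
have K0 : 0 <= K by have [k kK _] := H 0 (lexx _); apply: le_trans kK.
have A0 j : 0 <= \sum_i al i j * phi (a i).
  by apply: sumr_ge0 => i _; apply: mulr_ge0 => //; apply: phi_ge0.
have B0 j : 0 <= \sum_k be k j * phi (b k).
  by apply: sumr_ge0 => i _; apply: mulr_ge0 => //; apply: phi_ge0.
have z0 j : 0 <= z j by rewrite zE addr_ge0.
have zA i j : z j = 0 -> al i j * phi (a i) = 0.
  move=> zj; have /eqP : \sum_i al i j * phi (a i) = 0.
    by have := A0 j; have := B0 j; have := zE j; rewrite zj; lra.
  rewrite psumr_eq0 => [/allP/(_ i (mem_index_enum _))/eqP//|k _].
  by apply: mulr_ge0 => //; apply: phi_ge0.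
have zB i j : z j = 0 -> be i j * phi (b i) = 0.
  move=> zj; have /eqP : \sum_i be i j * phi (b i) = 0.
    by have := A0 j; have := B0 j; have := zE j; rewrite zj; lra.
  rewrite psumr_eq0 => [/allP/(_ i (mem_index_enum _))/eqP//|k _].
  by apply: mulr_ge0 => //; apply: phi_ge0.
have PA := positive_part_ineq H phi0 w0 s0 a0 (fun i => phi_ge0 _ (a0 i)) alB ale ez z0 zA za.
have PB := positive_part_ineq H phi0 w0 s0 b0 (fun i => phi_ge0 _ (b0 i)) beB bee ez z0 zB zb.
have P : \sum_j Num.max (e j) 0 * w (s j) <=
    \sum_i Num.max (eA i) 0 * w (a i) + \sum_k Num.max (eB k) 0 * w (b k)
      + 3 * K * \sum_j e j ^+ 2.
  apply: (@le_trans _ _ (\sum_j (Num.max (e j) 0 * ((\sum_i al i j * phi (a i)) / z j * w (s j))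
     + Num.max (e j) 0 * ((\sum_i be i j * phi (b i)) / z j * w (s j)) + K * e j ^+ 2))).
    apply: ler_sum => j _; rewrite -mulrDr -mulrDl -mulrDl -zE.
    have [zj|zj] := eqVneq (z j) 0; last first.
      by rewrite mulfV // mul1r lerDl; apply: mulr_ge0 => //; apply: sqr_ge0.
    (* Here the two quotients are 0 instead of adding up to 1; but [phi (s j) = e j], so the
       Lipschitz bound gives [w (s j) <= K * e j] when [e j] is positive. *)
    rewrite zj mul0r mul0r mulr0 add0r.
    have [ej|ej] := ltP 0 (e j); last first.
      by rewrite mul0r; apply: mulr_ge0 => //; apply: sqr_ge0.
    have := supergradients_wrt_lip H (s0 j) (lexx 0); rewrite w0 phi0 !subr0 ez zj add0r.
    rewrite (gtr0_norm ej) => wK.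
    rewrite expr2 mulrCA; apply: ler_wpM2l; first exact: ltW.
    exact: le_trans (ler_norm _) wK.
  rewrite !big_split /= -mulr_sumr.
  by move: PA PB; lra.
(* For negative weights the second family drops out, and [phi (s j)] differs from [phi (a i)] by
   [e j] alone, so a Lipschitz comparison of [w (s j)] with [w (a i)] replaces concavity. *)
have N : \sum_j Num.min (e j) 0 * w (s j) <=
    \sum_i Num.min (eA i) 0 * w (a i) + \sum_k Num.min (eB k) 0 * w (b k)
      + K * \sum_j e j ^+ 2.
  rewrite [X in _ + X + _]big1 ?addr0; last first.
    move=> k _; have [/eB0 ->|ek] := ltP (eB k) 0; first by rewrite w0 mulr0.
    by rewrite mul0r.
  have -> : \sum_j Num.min (e j) 0 * w (s j) = \sum_i \sum_j al i j * (Num.min (eA i) 0 * w (s j)).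
    rewrite exchange_big; apply: eq_bigr => j _ /=.
    rewrite -[LHS]mul1r -(c1 j) mulr_suml; apply: eq_bigr => i _.
    by have [->|/ale ->//] := eqVneq (al i j) 0; rewrite !mul0r.
  rewrite -(@bistochastic_sum _ _ al e eA (fun x => x ^+ 2)) // mulr_sumr -big_split /=.
  apply: ler_sum => i _.
  rewrite -[leRHS]mul1r -(r1 i) mulr_suml; apply: ler_sum => j _.
  have [->|alj] := eqVneq (al i j) 0; first by rewrite !mul0r.
  apply: ler_wpM2l => //; have [ei|ei] := ltP (eA i) 0; last first.
    by rewrite !mul0r add0r; apply: mulr_ge0 => //; exact: sqr_ge0.
  have ej : e j < 0 by rewrite -(ale _ _ alj).
  have := supergradients_wrt_lip H (a0 i) (s0 j).
  rewrite (neg i j) // ez opprD addNKr normrN (ltr0_norm ej) (ale _ _ alj) => wK.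
  have := le_trans (ler_norm _) wK.
  have : 0 <= - e j by lra.
  nra.
have mm (x : R) : x = Num.max x 0 + Num.min x 0 by rewrite addr_max_min addr0.
have split (d y : 'I_n -> R) : \sum_j d j * y j =
    \sum_j Num.max (d j) 0 * y j + \sum_j Num.min (d j) 0 * y j.
  by rewrite -big_split; apply: eq_bigr => j _ /=; rewrite -mulrDl -mm.
have := split e (w \o s); have := split eA (w \o a); have := split eB (w \o b).
by rewrite /=; move: P N; lra.
Qed.

(** * Unitary diagonal forms *)

(** Takes its values in [R], whereas the norm of [R[i]] takes its values in [R[i]]. *)
Definition sqnormc (R : realType) (z : R[i]) : R := complex.Re z ^+ 2 + complex.Im z ^+ 2.

Lemma conjCE (R : realType) (z : R[i]) : (z^*)%R = conjc z.
Proof. by []. Qed.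

Lemma sqnormcE (R : realType) (z : R[i]) : (z^*)%R * z = (sqnormc z)%:C.
Proof.
by case: z => a b; rewrite conjCE /sqnormc /=; simpc; congr (_ +i* _); ring.
Qed.

Lemma sqnormc_ge0 (R : realType) (z : R[i]) : 0 <= sqnormc z.
Proof. by apply: addr_ge0; apply: sqr_ge0. Qed.

Lemma sqnormc_eq0 (R : realType) (z : R[i]) : (sqnormc z == 0) = (z == 0).
Proof.
case: z => a b; rewrite /sqnormc /= paddr_eq0 ?sqr_ge0 // !sqrf_eq0.
by rewrite eq_complex.
Qed.

Lemma sqnormcM (R : realType) (x y : R[i]) : sqnormc (x * y) = sqnormc x * sqnormc y.
Proof. by case: x => a b; case: y => c d; rewrite /sqnormc; simpc => /=; ring. Qed.

Lemma sqnormcC (R : realType) (x : R[i]) : sqnormc (x^*)%R = sqnormc x.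
Proof. by case: x => a b; rewrite conjCE /sqnormc /=; ring. Qed.

Lemma sqnormc_real (R : realType) (x : R) : sqnormc x%:C = x ^+ 2.
Proof. by rewrite /sqnormc /=; ring. Qed.

Lemma ReZ (R : realType) (r : R) (z : R[i]) : complex.Re (r%:C * z) = r * complex.Re z.
Proof. by case: z => a b; simpc. Qed.

Lemma ReD (R : realType) (x y : R[i]) : complex.Re (x + y) = complex.Re x + complex.Re y.
Proof. by case: x => a b; case: y. Qed.

Lemma Re_sum (R : realType) (I : finType) (F : I -> R[i]) :
  complex.Re (\sum_i F i) = \sum_i complex.Re (F i).
Proof. exact: (raddf_sum (@complex.Re R)). Qed.

Lemma trmxC_mul (R : realType) m n p (A : 'M[R[i]]_(m, n)) (B : 'M[R[i]]_(n, p)) :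
  (A *m B)^t* = B^t* *m A^t*.
Proof. by rewrite trmx_mul map_mxM. Qed.

Lemma trmxC_add (R : realType) m n (A B : 'M[R[i]]_(m, n)) : (A + B)^t* = A^t* + B^t*.
Proof. by rewrite linearD /= map_mxD. Qed.

Lemma unitary_mulC (R : realType) n (P : 'M[R[i]]_n) : P \is unitarymx -> P^t* *m P = 1%:M.
Proof. by move/unitarymxP/mulmx1C. Qed.

Lemma unitary_trC (R : realType) n (P : 'M[R[i]]_n) : P \is unitarymx -> P^t* \is unitarymx.
Proof. by move=> /unitary_mulC PU; apply/unitarymxP; rewrite trmxCK. Qed.

Lemma unitary_mul_trC (R : realType) n (P Q : 'M[R[i]]_n) :
  P \is unitarymx -> Q \is unitarymx -> P *m Q^t* \is unitarymx.
Proof.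
move=> /unitarymxP PU /unitary_mulC QU; apply/unitarymxP.
by rewrite trmxC_mul trmxCK mulmxA -[_ *m Q]mulmxA QU mulmx1.
Qed.

Lemma unitary_mul (R : realType) n (P Q : 'M[R[i]]_n) :
  P \is unitarymx -> Q \is unitarymx -> P *m Q \is unitarymx.
Proof.
move=> /unitarymxP PU /unitarymxP QU; apply/unitarymxP.
by rewrite trmxC_mul mulmxA -[_ *m Q^t*]mulmxA QU mulmx1.
Qed.

(** A Hermitian matrix together with a chosen eigenbasis and real eigenvalues, so that the
    functional calculus acts on [d] alone. *)
Definition udiag (R : realType) n (P : 'M[R[i]]_n) (d : 'rV[R]_n) : 'M[R[i]]_n :=
  P^t* *m diag_mx (map_mx (real_complex R) d) *m P.

Lemma udiagE (R : realType) n (P : 'M[R[i]]_n) (d : 'rV[R]_n) i j :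
  udiag P d i j = \sum_k (d 0 k)%:C * (((P k i)^*)%R * P k j).
Proof.
rewrite !mxE; apply: eq_bigr => k _.
by rewrite mul_mx_diag !mxE; ring.
Qed.

Lemma udiagD (R : realType) n (P : 'M[R[i]]_n) (d e : 'rV[R]_n) :
  udiag P (d + e) = udiag P d + udiag P e.
Proof. by rewrite /udiag map_mxD linearD /= mulmxDr mulmxDl. Qed.

Lemma udiagZ (R : realType) n (P : 'M[R[i]]_n) (r : R) (d : 'rV[R]_n) :
  udiag P (r *: d) = r%:C *: udiag P d.
Proof. by rewrite /udiag map_mxZ linearZ /= -scalemxAr -scalemxAl. Qed.

Lemma udiagB (R : realType) n (P : 'M[R[i]]_n) (d e : 'rV[R]_n) :
  udiag P (d - e) = udiag P d - udiag P e.
Proof. by rewrite -scaleN1r udiagD udiagZ rmorphN scaleN1r. Qed.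

Lemma udiag_herm (R : realType) n (P : 'M[R[i]]_n) (d : 'rV[R]_n) :
  (udiag P d)^t* = udiag P d.
Proof.
rewrite /udiag 2!trmxC_mul trmxCK mulmxA tr_diag_mx map_diag_mx; congr (_ *m diag_mx _ *m _).
by apply/rowP => i; rewrite !mxE -[LHS]/(conjc _) /= oppr0.
Qed.

Lemma udiag_mulr (R : realType) n (P Q : 'M[R[i]]_n) (d : 'rV[R]_n) :
  udiag (P *m Q) d = Q^t* *m udiag P d *m Q.
Proof. by rewrite /udiag trmxC_mul !mulmxA. Qed.

Lemma udiag_quad (R : realType) n m (P : 'M[R[i]]_n) (d : 'rV[R]_n) (v : 'M[R[i]]_(n, m)) j :
  (v^t* *m udiag P d *m v) j j = (\sum_i d 0 i * sqnormc ((P *m v) i j))%:C.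
Proof.
rewrite /udiag !mulmxA -mulmxA -trmxC_mul; set w := P *m v.
rewrite mxE rmorph_sum; apply: eq_bigr => i _.
by rewrite mul_mx_diag !mxE rmorphM /= -sqnormcE mulrAC mulrC.
Qed.

(** The change of basis W satisfies diag(d) W = W diag(e); compare entries. *)
Lemma udiag_intertwine (R : realType) n (P Q : 'M[R[i]]_n) (d e : 'rV[R]_n) i j :
  P \is unitarymx -> Q \is unitarymx -> udiag P d = udiag Q e ->
  (P *m Q^t*) i j != 0 -> d 0 i = e 0 j.
Proof.
move=> PU QU de Wij.
have : P *m udiag P d *m Q^t* = P *m udiag Q e *m Q^t* by rewrite de.
rewrite {1}/udiag !mulmxA (unitarymxP PU) mul1mx -mulmxA.
rewrite /udiag !mulmxA -[_ *m Q *m Q^t*]mulmxA (unitarymxP QU) mulmx1.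
move: Wij; rewrite -mulmxA; move: (P *m Q^t*) => W Wij /matrixP/(_ i j).
by rewrite mul_diag_mx mul_mx_diag !mxE mulrC => /(mulfI Wij)/complexI.
Qed.

Lemma unitary_row_sum (R : realType) n (P Q : 'M[R[i]]_n) i :
  P \is unitarymx -> Q \is unitarymx -> \sum_j sqnormc ((P *m Q^t*) i j) = 1.
Proof.
move=> PU QU; have WU := unitary_mul_trC PU QU.
have := unitarymxP WU; move: (P *m Q^t*) {WU} => W /matrixP/(_ i i).
rewrite [RHS]mxE eqxx => WW.
apply: (@complexI R); rewrite rmorph1 -[RHS]WW [RHS]mxE rmorph_sum; apply: eq_bigr => j _.
by rewrite [RHS]mulrC !mxE /= -sqnormcE.
Qed.

Lemma unitary_col_sum (R : realType) n (P Q : 'M[R[i]]_n) j :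
  P \is unitarymx -> Q \is unitarymx -> \sum_i sqnormc ((P *m Q^t*) i j) = 1.
Proof.
move=> PU QU; have WU := unitary_mul_trC PU QU.
have := unitary_mulC WU; move: (P *m Q^t*) {WU} => W /matrixP/(_ j j).
rewrite [RHS]mxE eqxx => WW.
apply: (@complexI R); rewrite rmorph1 -[RHS]WW [RHS]mxE rmorph_sum; apply: eq_bigr => i _.
by rewrite !mxE /= -sqnormcE.
Qed.

(** * The Frobenius inner product *)

Definition frob (R : realType) n (X Y : 'M[R[i]]_n) : R :=
  complex.Re (\tr (X *m Y^t*)).

Lemma frobE (R : realType) n (X Y : 'M[R[i]]_n) :
  frob X Y = \sum_i \sum_j complex.Re (X i j * ((Y i j)^*)%R).
Proof.
rewrite /frob /mxtrace Re_sum; apply: eq_bigr => i _.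
by rewrite mxE Re_sum; apply: eq_bigr => j _; rewrite !mxE.
Qed.

Lemma frobC (R : realType) n (X Y : 'M[R[i]]_n) : frob X Y = frob Y X.
Proof.
rewrite !frobE; apply: eq_bigr => i _; apply: eq_bigr => j _.
by case: (X i j) => a b; case: (Y i j) => c d; rewrite !conjCE /=; ring.
Qed.

Lemma frobDl (R : realType) n (X Y Z : 'M[R[i]]_n) : frob (X + Y) Z = frob X Z + frob Y Z.
Proof. by rewrite /frob mulmxDl linearD ReD. Qed.

Lemma frobZl (R : realType) n (r : R) (X Z : 'M[R[i]]_n) : frob (r%:C *: X) Z = r * frob X Z.
Proof. by rewrite /frob -scalemxAl linearZ /= ReZ. Qed.

Lemma frobBl (R : realType) n (X Y Z : 'M[R[i]]_n) : frob (X - Y) Z = frob X Z - frob Y Z.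
Proof. by rewrite -scaleN1r -(rmorphN1 (real_complex R)) frobDl frobZl mulN1r. Qed.

Lemma frobDr (R : realType) n (X Y Z : 'M[R[i]]_n) : frob Z (X + Y) = frob Z X + frob Z Y.
Proof. by rewrite frobC frobDl !(frobC Z). Qed.

Lemma frobBr (R : realType) n (X Y Z : 'M[R[i]]_n) : frob Z (X - Y) = frob Z X - frob Z Y.
Proof. by rewrite frobC frobBl !(frobC Z). Qed.

Lemma frobZr (R : realType) n (r : R) (X Z : 'M[R[i]]_n) : frob Z (r%:C *: X) = r * frob Z X.
Proof. by rewrite frobC frobZl frobC. Qed.

Lemma frob_sqnormc (R : realType) n (X : 'M[R[i]]_n) : frob X X = \sum_i \sum_j sqnormc (X i j).
Proof.
rewrite frobE; apply: eq_bigr => i _; apply: eq_bigr => j _.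
by rewrite mulrC sqnormcE.
Qed.

Lemma frob_ge0 (R : realType) n (X : 'M[R[i]]_n) : 0 <= frob X X.
Proof.
by rewrite frob_sqnormc; apply: sumr_ge0 => i _; apply: sumr_ge0 => j _; exact: sqnormc_ge0.
Qed.

Lemma frob_eq0 (R : realType) n (X : 'M[R[i]]_n) : frob X X = 0 -> X = 0.
Proof.
rewrite frob_sqnormc pair_big => /eqP; rewrite psumr_eq0 => [/allP X0|ij _]; last exact: sqnormc_ge0.
apply/matrixP => i j; have := X0 (i, j) (mem_index_enum _).
by rewrite /= sqnormc_eq0 mxE => /eqP.
Qed.

Lemma frob_udiag (R : realType) n (P : 'M[R[i]]_n) (d e : 'rV[R]_n) :
  P \is unitarymx -> frob (udiag P d) (udiag P e) = \sum_i d 0 i * e 0 i.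
Proof.
move=> /unitarymxP PP; rewrite /frob udiag_herm /udiag !mulmxA.
rewrite -[_ *m P *m P^t*]mulmxA PP mulmx1 mxtrace_mulC !mulmxA PP mul1mx.
rewrite /mxtrace Re_sum; apply: eq_bigr => i _.
by rewrite mul_diag_mx !mxE eqxx mulr1n ReZ.
Qed.

(** * First-order conditions on unitary orbits *)

(** The form takes the eigenvalues as its values at the eigenvectors. It will be applied to a
    commutator of Hermitian matrices, which is skew-Hermitian and hence normal. *)
Lemma normal_quad_eq0 (R : realType) n (M : 'M[R[i]]_n) :
  M \is normalmx -> (forall v : 'cV[R[i]]_n, (v^t* *m M *m v) 0 0 = 0) -> M = 0.
Proof.
move/orthomx_spectralP => ME H; rewrite ME.
have QU := spectral_unitarymx M; move: (spectralmx M) (spectral_diag M) QU ME => Q d QU ME.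
suff -> : d = 0 by rewrite linear0 mulmx0 mul0mx.
apply/rowP => i; rewrite mxE.
have := H ((row i Q)^t*); rewrite trmxCK.
have -> : (row i Q *m M *m (row i Q)^t*) 0 0 = (Q *m M *m Q^t*) i i.
  by rewrite -row_mul !mxE; apply: eq_bigr => k _; rewrite !mxE.
rewrite ME invmx_unitary // !mulmxA (unitarymxP QU) mul1mx -mulmxA (unitarymxP QU).
by rewrite mulmx1 mxE eqxx.
Qed.

(** At x = c / (|m| + 1) the expression equals x^2 (|m| + 1 + m), which is positive unless c = 0. *)
Lemma quadratic_le0_linear_coef (R : realType) (c m : R) : (forall x, x * c + x ^+ 2 * m <= 0) -> c = 0.
Proof.
move=> H; apply/eqP/negPn/negP => c0.
have M0 : 0 < `|m| + 1 by have := normr_ge0 m; lra.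
have := H (c / (`|m| + 1)).
have -> : c / (`|m| + 1) * c + (c / (`|m| + 1)) ^+ 2 * m =
   (c / (`|m| + 1)) ^+ 2 * (`|m| + 1 + m) by field; lra.
apply/negP; rewrite -ltNge; apply: mulr_gt0.
  by rewrite exprn_even_gt0 //= mulf_neq0 // invr_neq0 // gt_eqF.
by have := ler_norm (- m); rewrite normrN; lra.
Qed.

Lemma phase_modulus (R : realType) (x N : R) :
  let y := 1 + x ^+ 2 * N ^+ 2 in
  (- (2 * x / y) * (x * N)) ^+ 2 + (2 * x / y) ^+ 2 = 4 * x ^+ 2 / y.
Proof.
have y0 : 0 < 1 + x ^+ 2 * N ^+ 2 by rewrite -exprMn; have := sqr_ge0 (x * N); lra.
by move=> /=; field; lra.
Qed.

Lemma Re_perturb (R : realType) (x c k u : R[i]) (r m : R) :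
  k * (k^*)%R = r%:C -> m = complex.Re u ->
  complex.Re (x + k * c + (k^*)%R * (c^*)%R + k * (k^*)%R * u) =
  complex.Re x + 2 * complex.Re (k * c) + r * m.
Proof.
move=> -> ->; rewrite !ReD ReZ.
have -> : complex.Re ((k^*)%R * (c^*)%R) = complex.Re (k * c).
  by rewrite -rmorphM; case: (k * c).
by ring.
Qed.

Lemma perturb_expand (R : realType) n (X D V : 'M[R[i]]_n) (k l : R[i]) :
  X *m ((1%:M + l *: V) *m D *m (1%:M + k *: V)) =
  X *m D + k *: (X *m D *m V) + l *: (X *m V *m D) + (k * l) *: (X *m V *m D *m V).
Proof.
rewrite mulmxDl mul1mx mulmxDr mulmx1 mulmxDr -!addrA.
have -> : X *m (D + l *: V *m D) = X *m D + l *: (X *m V *m D).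
  by rewrite mulmxDr -scalemxAl -scalemxAr mulmxA.
have -> : X *m ((D + l *: V *m D) *m (k *: V)) =
    k *: (X *m D *m V) + (k * l) *: (X *m V *m D *m V).
  rewrite -scalemxAr -scalemxAr mulmxDl mulmxDr scalerDr mulmxA.
  by rewrite -scalemxAl -scalemxAl -scalemxAr scalerA !mulmxA.
by rewrite -[LHS]addrA [X in _ + X = _]addrCA.
Qed.

(* Perturbing by the unitaries 1 + kappa v v^* gives the first-order condition. *)
Lemma max_overlap_comm (R : realType) n (X P : 'M[R[i]]_n) (d : 'rV[R]_n) :
  X^t* = X -> P \is unitarymx ->
  (forall Q, Q \is unitarymx -> frob X (udiag Q d) <= frob X (udiag P d)) ->
  X *m udiag P d = udiag P d *m X.
Proof.
move=> XH PU H; set D := udiag P d.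
have DH : D^t* = D by apply: udiag_herm.
have XDC : (X *m D)^t* = D *m X by rewrite trmxC_mul XH; congr (_ *m _).
have DXC : (D *m X)^t* = X *m D by rewrite trmxC_mul XH; congr (_ *m _).
apply/eqP; rewrite -subr_eq0; apply/eqP/normal_quad_eq0.
  apply/normalmxP.
  have -> : (X *m D - D *m X)^t* = - (X *m D - D *m X).
    by rewrite linearB /= map_mxB XDC DXC opprB.
  by rewrite mulNmx mulmxN.
move=> v; rewrite mulmxBr mulmxBl -XDC.
set M := X *m D.
have -> : (v^t* *m M *m v - v^t* *m M^t* *m v) 0 0 =
   (v^t* *m M *m v) 0 0 - (((v^t* *m M *m v) 0 0)^*)%R.
  have -> : v^t* *m M^t* *m v = (v^t* *m M *m v)^t*.
    by rewrite [RHS]trmxC_mul [in RHS]trmxC_mul trmxCK mulmxA.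
  by move: (v^t* *m M *m v) => Y; rewrite !mxE.
set c := (v^t* *m M *m v) 0 0.
(* The form of the commutator at [v] is [c] minus its conjugate, so only the imaginary part of [c]
   has to vanish. *)
suff /eqP : - complex.Im c = 0.
  by rewrite oppr_eq0; case: (c) => a b /= /eqP ->; rewrite conjCE /= oppr0 subrr.
pose N := \sum_i sqnormc (v i 0).
have vv : v^t* *m v = (N%:C)%:M.
  apply/matrixP => i j; rewrite !ord1 !mxE eqxx mulr1n rmorph_sum.
  by apply: eq_bigr => k _; rewrite !mxE /= -sqnormcE.
pose m := complex.Re ((v^t* *m X *m v) 0 0 * (v^t* *m D *m v) 0 0).
apply: (@quadratic_le0_linear_coef _ _ (- N * complex.Re c + m)) => x.
pose y := 1 + x ^+ 2 * N ^+ 2.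
have y0 : 0 < y by rewrite /y -exprMn; have := sqr_ge0 (x * N); lra.
(* This makes 1 + k V the Cayley transform of i x V, for V = v v^* as below: on the line of [v] it
   acts as (1 + i x N) / (1 - i x N), a number of modulus 1. *)
pose k : R[i] := (- (2 * x / y) * (x * N)) +i* (2 * x / y).
pose V := v *m v^t*.
have VC : V^t* = V by rewrite /V trmxC_mul trmxCK.
pose G := 1%:M + k *: V.
have GC : G^t* = 1%:M + (k^*)%R *: V.
  rewrite /G trmxC_add linearZ /= map_mxZ VC trmx1 map_mx1; congr (_ + _ *: _).
have kk : k * (k^*)%R = ((4 * x ^+ 2 / y)%:C)%C.
  rewrite mulrC sqnormcE /sqnormc /k /=; congr (_ %:C).
  exact: phase_modulus.
have VV : V *m V = N%:C *: V.
  by rewrite /V mulmxA -[_ *m v]mulmxA vv mul_mx_scalar scalemxAl.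
have GU : G \is unitarymx.
  apply/unitarymxP; rewrite GC /G mulmxDl !mulmxDr !mul1mx mulmx1.
  rewrite -scalemxAl -scalemxAr VV !scalerA -addrA -!scalerDl.
  rewrite [X in X *: V](_ : _ = 0) ?scale0r ?addr0 // kk conjCE /k /=; simpc.
  by congr (_ +i* _); ring.
have := H _ (unitary_mul PU GU).
rewrite udiag_mulr -/D {1}/frob; have -> : (G^t* *m D *m G)^t* = G^t* *m D *m G.
  by rewrite trmxC_mul [X in _ *m X]trmxC_mul trmxCK DH mulmxA.
have trV Y : \tr (Y *m V) = (v^t* *m Y *m v) 0 0.
  by rewrite /V mulmxA mxtrace_mulC mulmxA /mxtrace big_ord_recl big_ord0 addr0.
have -> : \tr (X *m (G^t* *m D *m G)) = \tr (X *m D) + k * c +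
    (k^*)%R * (c^*)%R + k * (k^*)%R * ((v^t* *m X *m v) 0 0 * (v^t* *m D *m v) 0 0).
  have -> : X *m (G^t* *m D *m G) = X *m D + k *: (X *m D *m V) +
      (k^*)%R *: (X *m V *m D) + (k * (k^*)%R) *: (X *m V *m D *m V).
    by rewrite GC; exact: perturb_expand.
  rewrite !linearD !linearZ /= !trV /=; congr (_ + _ * _ + _ * _ + _ * _).
    rewrite mxtrace_mulC mulmxA trV /c.
    have -> : v^t* *m (D *m X) *m v = (v^t* *m M *m v)^t*.
      by rewrite [RHS]trmxC_mul [in RHS]trmxC_mul trmxCK XDC mulmxA.
    by move: (v^t* *m M *m v) => Y; rewrite !mxE.
  have -> : v^t* *m (X *m V *m D) *m v = (v^t* *m X *m v) *m (v^t* *m D *m v).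
    by rewrite /V !mulmxA.
  by move: (v^t* *m X *m v) (v^t* *m D *m v) => Y Z; rewrite mxE big_ord_recl big_ord0 addr0.
have -> : frob X D = complex.Re (\tr (X *m D)) by rewrite /frob DH.
rewrite (Re_perturb _ _ kk (erefl m)).
have -> : complex.Re (k * c) = 2 * (x / y) * (- (x * N) * complex.Re c - complex.Im c).
  by rewrite /k; case: (c) => a b; simpc => /=; field; clear -y0; lra.
(* [y] depends on [x]; multiplying the gain by y / 4 leaves a polynomial in [x] with linear
   coefficient - Im c. *)
have -> : x * - complex.Im c + x ^+ 2 * (- N * complex.Re c + m) = (y / 4) *
   (2 * (2 * (x / y) * (- (x * N) * complex.Re c - complex.Im c)) + 4 * x ^+ 2 / y * m).
  by field; clear -y0; lra.
move=> le; apply: mulr_ge0_le0; first by apply: divr_ge0 => //; exact: ltW.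
by clear -le; lra.
Qed.


Lemma half_sum_inj (K : numFieldType) (V : lmodType K) (A Z A' Z' : V) :
  A + Z = A' + Z' -> A - Z = A' - Z' -> A = A'.
Proof.
move=> E E'; have two0 : (2 : K) != 0 by rewrite pnatr_eq0.
have : A + Z + (A - Z) = A' + Z' + (A' - Z') by rewrite E E'.
rewrite addrACA subrr addr0 [RHS]addrACA subrr addr0 -!mulr2n -!scaler_nat.
exact: scalerI.
Qed.

Lemma hermitian_parts_inj (R : realType) n (A B A' B' : 'M[R[i]]_n) :
  A^t* = A -> B^t* = B -> A'^t* = A' -> B'^t* = B' ->
  A + 'i *: B = A' + 'i *: B' -> A = A' /\ B = B'.
Proof.
have tr (X Y : 'M[R[i]]_n) : X^t* = X -> Y^t* = Y -> (X + 'i *: Y)^t* = X - 'i *: Y.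
  by move=> XH YH; rewrite trmxC_add XH linearZ /= map_mxZ YH /= conjCi scaleNr.
move=> AH BH AH' BH' E; have E' : A - 'i *: B = A' - 'i *: B' by rewrite -!tr // E.
have AA : A = A' := half_sum_inj E E'.
by split=> //; move: E; rewrite AA => /addrI; apply: scalerI; exact: neq0Ci.
Qed.

Lemma udiag_row_perm (R : realType) n (Q : 'M[R[i]]_n) (d : 'rV[R]_n) (s : 'S_n) :
  udiag (row_perm s Q) (\row_i d 0 (s i)) = udiag Q d.
Proof.
apply/matrixP => i j; rewrite !udiagE [RHS](reindex_inj (@perm_inj _ s)).
by apply: eq_bigr => k _; rewrite !mxE.
Qed.

Lemma unitary_row_perm (R : realType) n (Q : 'M[R[i]]_n) (s : 'S_n) :
  Q \is unitarymx -> row_perm s Q \is unitarymx.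
Proof.
move/unitarymxP => QQ; apply/unitarymxP/matrixP => i j.
have /matrixP/(_ (s i) (s j)) := QQ; rewrite !mxE (inj_eq perm_inj) => <-.
by apply: eq_bigr => k _; rewrite !mxE.
Qed.

Lemma unitary_transversal (R : realType) n (W : 'M[R[i]]_n) :
  W \is unitarymx -> exists s : 'S_n, forall i, W i (s i) != 0.
Proof.
move=> /unitarymx_unit; rewrite unitmxE unitfE => detW.
have [/existsP[s /forallP Hs]|] := boolP [exists s : 'S_n, forall i, W i (s i) != 0].
  by exists s.
rewrite negb_exists => /forallP H; case/eqP: detW; apply: big1 => s _.
have := H s; rewrite negb_forall => /existsP[i /negPn/eqP Wi].
by rewrite (bigD1 i) //= Wi mul0r mulr0.
Qed.

Lemma mul_diag_mx_lin (K : comPzRingType) n (M N : 'M[K]_n) (a b : 'rV[K]_n) (z : K) :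
  M *m diag_mx (a + z *: b) *m N = M *m diag_mx a *m N + z *: (M *m diag_mx b *m N).
Proof. by rewrite linearD linearZ /= mulmxDr mulmxDl -scalemxAr -scalemxAl. Qed.

(* The normal matrix [udiag P d + i E] diagonalizes both terms at once; the
   permutation matching the two orderings of the eigenvalues comes from a nonzero
   term of the Leibniz expansion of the determinant of the change of basis. *)
Lemma codiag (R : realType) n (E P : 'M[R[i]]_n) (d : 'rV[R]_n) :
  E^t* = E -> P \is unitarymx -> E *m udiag P d = udiag P d *m E ->
  exists Q (e : 'rV[R]_n), [/\ Q \is unitarymx, udiag Q d = udiag P d & udiag Q e = E].
Proof.
move=> EH PU comm; set D := udiag P d in comm *.
have DH : D^t* = D by apply: udiag_herm.
pose N := D + 'i *: E.
have NC : N^t* = D - 'i *: E.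
  by rewrite /N trmxC_add DH linearZ /= map_mxZ EH /= conjCi scaleNr.
have [Q [c [QU NE]]] : exists Q (c : 'rV[R[i]]_n), Q \is unitarymx /\ N = Q^t* *m diag_mx c *m Q.
  exists (spectralmx N), (spectral_diag N); split; first exact: spectral_unitarymx.
  rewrite -invmx_unitary ?spectral_unitarymx //; apply/orthomx_spectralP/normalmxP.
  rewrite NC /N; move: comm => /(congr1 (fun M => 'i *: M)) /=.
  rewrite scalemxAl scalemxAr => comm.
  rewrite mulmxDl !mulmxBr mulmxBl !mulmxDr comm addrA subrK.
  by rewrite opprD addrA addrK.
pose x := map_mx (@complex.Re R) c; pose y := map_mx (@complex.Im R) c.
have cE : c = map_mx (real_complex R) x + 'i *: map_mx (real_complex R) y.
  by apply/rowP => k; rewrite !mxE [LHS]complexE complexiE.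
have : N = udiag Q x + 'i *: udiag Q y.
  by rewrite NE cE; exact: mul_diag_mx_lin.
move/(hermitian_parts_inj DH EH (udiag_herm _ _) (udiag_herm _ _)) => [DQ EQ].
have [s Ws] := unitary_transversal (unitary_mul_trC PU QU).
have dx : d = \row_i x 0 (s i).
  by apply/rowP => i; rewrite mxE; apply: udiag_intertwine PU QU DQ (Ws i).
exists (row_perm s Q), (\row_i y 0 (s i)); rewrite {1}dx !udiag_row_perm.
by split; [exact: unitary_row_perm|exact: esym DQ|exact: esym EQ].
Qed.

(** * Spectral form of a sum of two matrices *)

Lemma udiag_sum_quad (R : realType) n m (P0 P Q : 'M[R[i]]_n) (z x y : 'rV[R]_n)
    (v : 'M[R[i]]_(n, m)) j :
  udiag P0 z = udiag P x + udiag Q y ->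
  \sum_i z 0 i * sqnormc ((P0 *m v) i j) =
  \sum_i x 0 i * sqnormc ((P *m v) i j) + \sum_i y 0 i * sqnormc ((Q *m v) i j).
Proof.
move=> zE; apply: (@complexI R); rewrite rmorphD /= -!udiag_quad zE mulmxDr mulmxDl.
by rewrite mxE.
Qed.

(** Evaluate the quadratic forms at the eigenvector of index [j] in the basis [P0]. *)
Lemma udiag_sum_diag (R : realType) n (P0 P Q : 'M[R[i]]_n) (z x y : 'rV[R]_n) j :
  P0 \is unitarymx -> udiag P0 z = udiag P x + udiag Q y ->
  z 0 j = \sum_i sqnormc ((P *m P0^t*) i j) * x 0 i + \sum_i sqnormc ((Q *m P0^t*) i j) * y 0 i.
Proof.
move=> PU /(udiag_sum_quad (P0^t*) j); rewrite (unitarymxP PU) => zE.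
transitivity (\sum_i z 0 i * sqnormc ((1%:M : 'M[R[i]]_n) i j)).
  rewrite (bigD1 j) //= big1 => [|i ij]; first by rewrite mxE eqxx /sqnormc /=; ring.
  by rewrite mxE (negPf ij) /sqnormc /=; ring.
by rewrite zE; congr (_ + _); apply: eq_bigr => i _; rewrite mulrC.
Qed.

(* If [x v v^*] is below [Z], then [x (v^* Z^-1 v) <= 1]; [1 / 0 = 0] turns [Z^-1] into
   the pseudo-inverse. *)
Lemma udiag_sum_weight (R : realType) n (P0 P Q : 'M[R[i]]_n) (z x y : 'rV[R]_n) i :
  P0 \is unitarymx -> (forall k, 0 <= z 0 k) -> (forall k, 0 <= x 0 k) -> (forall k, 0 <= y 0 k) ->
  udiag P0 z = udiag P x + udiag Q y ->
  x 0 i * \sum_j sqnormc ((P *m P0^t*) i j) / z 0 j <= 1.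
Proof.
move=> PU z0 x0 y0 zE.
(* [u] holds the [P0]-coordinates of Z^-1 v, where v is the eigenvector of index [i] in [P]. There
   the form of Z equals q and the term of index [i] equals x q^2, so x q^2 <= q. *)
pose u : 'cV[R[i]]_n := \col_j (((P *m P0^t*) i j)^* * (z 0 j)^-1%:C)%R.
set q := \sum_j _.
have q0 : 0 <= q.
  by apply: sumr_ge0 => j _; apply: mulr_ge0; [exact: sqnormc_ge0|rewrite invr_ge0].
have := udiag_sum_quad (P0^t* *m u) 0 zE; rewrite !mulmxA (unitarymxP PU) mul1mx.
have -> : \sum_k z 0 k * sqnormc (u k 0) = q.
  apply: eq_bigr => k _; rewrite mxE sqnormcM sqnormcC sqnormc_real.
  have [->|zk] := eqVneq (z 0 k) 0; first by rewrite invr0 !(mul0r, mulr0).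
  by field.
have Wu : (P *m P0^t* *m u) i 0 = q%:C.
  rewrite mxE rmorph_sum; apply: eq_bigr => j _.
  by rewrite [u _ _]mxE mulrA [_ * (_^*)%R]mulrC sqnormcE /= rmorphM.
rewrite (bigD1 i) //= Wu sqnormc_real => qE.
have : x 0 i * q ^+ 2 <= q.
  rewrite [leRHS]qE -addrA lerDl; apply: addr_ge0; apply: sumr_ge0 => k _;
    by apply: mulr_ge0 => //; apply: sqnormc_ge0.
move: q0; rewrite le_eqVlt => /orP[/eqP <- _|q0]; first by rewrite mulr0.
by rewrite expr2 mulrA -[X in _ <= X -> _]mul1r ler_pM2r.
Qed.

(** Both E and phi(S) are diagonal in the basis [P0], hence so is X + Y = phi(S) - E, with
    eigenvalues [z]. The weights of the scalar inequality are the squared moduli of the entries of P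
    P0^* and Q P0^*. *)
Lemma matrix_trace_ineq (R : realType) n (K : R) (phi w : R -> R)
    (P0 P Q : 'M[R[i]]_n) (s a b eS eA eB : 'rV[R]_n) (E : 'M[R[i]]_n) :
  supergradients_wrt K phi w -> phi 0 = 0 -> w 0 = 0 -> (forall t, 0 <= t -> 0 <= phi t) ->
  P0 \is unitarymx -> P \is unitarymx -> Q \is unitarymx ->
  (forall j, 0 <= s 0 j) -> (forall j, 0 <= a 0 j) -> (forall j, 0 <= b 0 j) ->
  udiag P0 eS = E -> udiag P eA = E -> udiag Q eB = E ->
  udiag P0 (map_mx phi s) = udiag P (map_mx phi a) + udiag Q (map_mx phi b) + E ->
  (forall k, eB 0 k < 0 -> b 0 k = 0) ->
  frob E (udiag P0 (map_mx w s) - udiag P (map_mx w a) - udiag Q (map_mx w b))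
    <= 4 * K * frob E E.
Proof.
move=> H phi0 w0 phi_ge0 P0U PU QU s0 a0 b0 ES EA EB TE eB0.
pose z := map_mx phi s - eS.
have zE : udiag P0 z = udiag P (map_mx phi a) + udiag Q (map_mx phi b).
  by rewrite udiagB ES TE addrK.
have x0 k : 0 <= (map_mx phi a) 0 k by rewrite mxE; apply: phi_ge0.
have y0 k : 0 <= (map_mx phi b) 0 k by rewrite mxE; apply: phi_ge0.
have zd j := udiag_sum_diag j P0U zE.
have z0 k : 0 <= z 0 k.
  by rewrite zd; apply: addr_ge0; apply: sumr_ge0 => i _; apply: mulr_ge0 => //;
    apply: sqnormc_ge0.
have alE i j : sqnormc ((P *m P0^t*) i j) != 0 -> eA 0 i = eS 0 j.
  by rewrite sqnormc_eq0 => Wij; apply: udiag_intertwine PU P0U _ Wij; rewrite EA.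
have beE i j : sqnormc ((Q *m P0^t*) i j) != 0 -> eB 0 i = eS 0 j.
  by rewrite sqnormc_eq0 => Wij; apply: udiag_intertwine QU P0U _ Wij; rewrite EB.
have := @weighted_trace_ineq R n K phi w (fun i j => sqnormc ((P *m P0^t*) i j))
  (fun i j => sqnormc ((Q *m P0^t*) i j)) (s 0) (eS 0) (a 0) (eA 0) (b 0) (eB 0) (z 0).
rewrite 2!frobBr -{1}ES -{1}EA -{1}EB -{1 2}ES !frob_udiag //.
have mapw (e d : 'rV[R]_n) : \sum_i e 0 i * (map_mx w d) 0 i = \sum_i e 0 i * w (d 0 i).
  by apply: eq_bigr => i _; rewrite mxE.
have sqe : \sum_i eS 0 i * eS 0 i = \sum_i eS 0 i ^+ 2.
  by apply: eq_bigr => i _; rewrite expr2.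
rewrite !mapw sqe; apply => //.
- split=> [i j|i|j]; [exact: sqnormc_ge0|exact: unitary_row_sum|exact: unitary_col_sum].
- split=> [i j|i|j]; [exact: sqnormc_ge0|exact: unitary_row_sum|exact: unitary_col_sum].
- by move=> j; rewrite !mxE subrK.
- move=> j; rewrite zd; congr (_ + _); apply: eq_bigr => i _; by rewrite [X in _ * X]mxE.
- move=> i; have := udiag_sum_weight i P0U z0 x0 y0 zE; by rewrite [X in X * _]mxE.
- move=> i; rewrite addrC in zE.
  have := udiag_sum_weight i P0U z0 y0 x0 zE; by rewrite [X in X * _]mxE.
move=> i j ej Wij; rewrite sqnormc_eq0 in Wij.
have : P *m udiag P0 z *m P0^t* = P *m (udiag P (map_mx phi a) + udiag Q (map_mx phi b)) *m P0^t*.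
  by rewrite zE.
rewrite mulmxDr mulmxDl /udiag !mulmxA (unitarymxP PU) mul1mx.
rewrite -[_ *m P0 *m P0^t*]mulmxA (unitarymxP P0U) mulmx1.
rewrite -[_ *m P *m P0^t*]mulmxA -[_ *m Q *m P0^t*]mulmxA.
(* The eigenvector of index [j] in [P0], where E is negative, is orthogonal to every eigenvector of
   Y with nonzero eigenvalue. There X + Y acts as X, and entry (i, j) gives phi (a i) = z j. *)
have be0 k : phi (b 0 k) != 0 -> (Q *m P0^t*) k j = 0.
  move=> yk; apply/eqP; apply: contraTT yk; rewrite -sqnormc_eq0 => /beE ek.
  by rewrite eB0 ?phi0 ?eqxx // ek.
move: (P *m P0^t*) (P *m Q^t*) (Q *m P0^t*) be0 Wij => W W1 W2 be0 Wij.
move/matrixP/(_ i j); rewrite [RHS]mxE [X in _ = _ + X]mxE big1 ?addr0; last first.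
  move=> k _; have [yk|/be0 ->] := eqVneq (phi (b 0 k)) 0; last by rewrite mulr0.
  by rewrite mul_mx_diag !mxE yk mulr0 mul0r.
by rewrite mul_mx_diag mul_diag_mx !mxE [RHS]mulrC => /(mulfI Wij)/complexI /= <-.
Qed.

(** * Functional calculus in a chosen eigenbasis, and commutation *)

Lemma fun_calc_udiag (R : realType) n (g : R -> R) (P : 'M[R[i]]_n) (d : 'rV[R]_n) :
  P \is unitarymx -> fun_calc g (udiag P d) = udiag P (map_mx g d).
Proof. by move=> PU; rewrite /udiag -map_mx_comp; exact: fun_calcE. Qed.

Lemma udiag_map_eq (R : realType) n (g : R -> R) (P Q : 'M[R[i]]_n) (d e : 'rV[R]_n) :
  P \is unitarymx -> Q \is unitarymx -> udiag P d = udiag Q e ->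
  udiag P (map_mx g d) = udiag Q (map_mx g e).
Proof. by move=> PU QU de; rewrite -!fun_calc_udiag // de. Qed.

(** In the basis [P], commuting means that the entry (i, j) vanishes unless eigenvalues i and j
    coincide; an injective [phi] preserves and reflects these coincidences. *)
Lemma comm_udiag_inj (R : realType) n (phi : R -> R) (E P : 'M[R[i]]_n) (d : 'rV[R]_n) :
  P \is unitarymx -> (forall i j, phi (d 0 i) = phi (d 0 j) -> d 0 i = d 0 j) ->
  E *m udiag P (map_mx phi d) = udiag P (map_mx phi d) *m E ->
  E *m udiag P d = udiag P d *m E.
Proof.
move=> PU inj comm; have PP := unitary_mulC PU.
have [Y EE] : exists Y, E = P^t* *m Y *m P.
  by exists (P *m E *m P^t*); rewrite !mulmxA PP mul1mx -mulmxA PP mulmx1.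
have conj (x y : 'M[R[i]]_n) : (P^t* *m x *m P) *m (P^t* *m y *m P) = P^t* *m (x *m y) *m P.
  by rewrite !mulmxA -[_ *m P *m P^t*]mulmxA (unitarymxP PU) mulmx1.
have cancel (x y : 'M[R[i]]_n) : P^t* *m x *m P = P^t* *m y *m P -> x = y.
  move=> /(congr1 (fun M => P *m M *m P^t*)).
  by rewrite !mulmxA (unitarymxP PU) !mul1mx -!mulmxA (unitarymxP PU) !mulmx1.
have conjl D : E *m (P^t* *m D *m P) = P^t* *m (Y *m D) *m P by rewrite EE conj.
have conjr D : (P^t* *m D *m P) *m E = P^t* *m (D *m Y) *m P by rewrite EE conj.
have /cancel YD := etrans (esym (conjl _)) (etrans comm (conjr _)).
apply: etrans (conjl _) (etrans _ (esym (conjr _))).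
congr (_ *m _ *m _); move/matrixP: YD => YD; apply/matrixP => i j.
have := YD i j; rewrite !mul_mx_diag !mul_diag_mx !mxE.
have [->|Yij] := eqVneq (Y i j) 0; first by rewrite !(mul0r, mulr0).
by rewrite mulrC => /(mulIf Yij)/complexI/inj ->; rewrite mulrC.
Qed.

(** The norm is constant on a unitary orbit, so the nearest point of the orbit to X is the one of
    maximal overlap with X; subtracting that point from X preserves commutation with it. *)
Lemma comm_transfer (R : realType) n (phi : R -> R) (X P : 'M[R[i]]_n) (d : 'rV[R]_n) :
  X^t* = X -> P \is unitarymx ->
  (forall Q, Q \is unitarymx ->
    frob (X - udiag P (map_mx phi d)) (X - udiag P (map_mx phi d)) <=
    frob (X - udiag Q (map_mx phi d)) (X - udiag Q (map_mx phi d))) ->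
  (X - udiag P (map_mx phi d)) *m udiag P (map_mx phi d) =
  udiag P (map_mx phi d) *m (X - udiag P (map_mx phi d)).
Proof.
move=> XH PU H; rewrite mulmxBl mulmxBr; congr (_ - _).
apply: max_overlap_comm => // Q QU; have := H Q QU.
rewrite !(frobBl, frobBr) !frob_udiag // !(frobC _ X).
by move: (frob X X) (frob X _) (frob X _) (\sum_i _) => x y z t; lra.
Qed.

(** * The gap and its minimizers *)

Definition gap (R : realType) n (phi : R -> R) (P0 P Q : 'M[R[i]]_n) (s a c : 'rV[R]_n) :=
  udiag P0 (map_mx phi s) - udiag P (map_mx phi a) - udiag Q (map_mx phi c).

(** The conjugating unitaries are absorbed into the eigenbases: the orbit of phi(A) consists of the
    matrices [udiag P (map_mx phi a)] with [P] unitary. *)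
Definition feasible (R : realType) n (P Q : 'M[R[i]]_n) (b c : 'rV[R]_n) :=
  [/\ P \is unitarymx, Q \is unitarymx & forall k, 0 <= c 0 k <= b 0 k].

Definition gap_minimizer (R : realType) n (phi : R -> R) (P0 P Q : 'M[R[i]]_n) (s a b c : 'rV[R]_n) :=
  feasible P Q b c /\ forall P' Q' c', feasible P' Q' b c' ->
    frob (gap phi P0 P Q s a c) (gap phi P0 P Q s a c) <=
    frob (gap phi P0 P' Q' s a c') (gap phi P0 P' Q' s a c').

Lemma frob_square_add (R : realType) n (X Y : 'M[R[i]]_n) :
  frob (X + Y) (X + Y) = frob X X + 2 * frob X Y + frob Y Y.
Proof. by rewrite frobDl [frob X (X + Y)]frobDr [frob Y (X + Y)]frobDr (frobC Y X); ring. Qed.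

Lemma addr_sub_cancel (V : zmodType) (T A X Y : V) : T - A - X + (X - Y) = T - A - Y.
Proof. by rewrite addrA subrK. Qed.

Lemma eq_addr_sub (V : zmodType) (T A X T' A' X' : V) :
  T = T' -> A = A' -> X = X' -> T - A - X = T' - A' - X'.
Proof. by move=> -> -> ->. Qed.

Lemma eq_addr2 (V : zmodType) (T A X T' A' : V) :
  T = T' -> A = A' -> T + A + X = T' + A' + X.
Proof. by move=> -> ->. Qed.

(* Otherwise lowering [c 0 k] a little would decrease the norm of the gap. *)
Lemma gap_min_psd (R : realType) n (phi : R -> R) (M : R) (P0 P Q : 'M[R[i]]_n)
    (s a b c e : 'rV[R]_n) k :
  (forall x y, 0 <= x -> x < y -> phi x < phi y) ->
  (forall x y, 0 <= x -> x <= y -> phi y - phi x <= M * (y - x)) ->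
  gap_minimizer phi P0 P Q s a b c -> udiag Q e = gap phi P0 P Q s a c ->
  e 0 k < 0 -> c 0 k = 0.
Proof.
move=> mono lip [[PU QU c0] cmin] eE ek.
have /andP[ck0 ckb] := c0 k.
apply/eqP/negPn/negP => ckn; have ck : 0 < c 0 k by rewrite lt_def ckn.
have M0 : 0 <= M.
  by have := mono 0 1 (lexx _) ltr01; have := lip 0 1 (lexx _) ler01; clear; lra.
(* Lowering [c 0 k] by tau raises [e 0 k] by some eta > 0 and changes the squared norm by eta (2 e_k
   + eta). The first bound keeps [c] nonnegative; the second gives eta <= M tau < - 2 e_k. *)
pose tau := Num.min (c 0 k) (- e 0 k / (M + 1)).
have tau0 : 0 < tau.
  by rewrite lt_min ck /=; apply: divr_gt0; clear -ek M0; lra.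
have tauc : tau <= c 0 k by rewrite ge_min lexx.
have taue : M * tau < - 2 * e 0 k.
  have : tau <= - e 0 k / (M + 1) by rewrite ge_min lexx orbT.
  rewrite ler_pdivlMr; last by clear -M0; lra.
  by clear -ek M0 tau0; nra.
pose c' : 'rV[R]_n := \row_j (if j == k then c 0 k - tau else c 0 j).
pose eta := phi (c 0 k) - phi (c 0 k - tau).
have eta0 : 0 < eta.
  by rewrite subr_gt0; apply: mono; clear -tauc tau0; lra.
have etae : eta < - 2 * e 0 k.
  apply: le_lt_trans taue; have := lip (c 0 k - tau) (c 0 k).
  by rewrite subKr; apply; clear -tauc tau0; lra.
have fc' : feasible P Q b c'.
  split=> // j; rewrite mxE; case: eqP => [->|_]; last exact: c0.
  by apply/andP; split; clear -tauc tau0 ckb; lra.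
have := cmin _ _ _ fc'.
have -> : gap phi P0 P Q s a c' = udiag Q (e + eta *: delta_mx 0 k).
  have -> : udiag Q (e + eta *: delta_mx 0 k) = udiag Q e + udiag Q (map_mx phi c - map_mx phi c').
    rewrite -udiagD; congr (udiag _ (_ + _)); apply/rowP => j; rewrite !mxE eqxx /=.
    by case: eqP => [->|_]; rewrite ?mulr1 // mulr0 subrr.
  by rewrite eE udiagB; symmetry; exact: addr_sub_cancel.
rewrite -eE (udiagD Q) frob_square_add !(frob_udiag _ _ QU).
have sum1 (f : 'I_n -> R) : \sum_i f i * (eta *: (delta_mx 0 k : 'rV[R]_n)) 0 i = f k * eta.
  rewrite (bigD1 k) //= big1 ?addr0 => [|i ik]; first by rewrite !mxE !eqxx mulr1.
  by rewrite !mxE (negPf ik) andbF !mulr0.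
rewrite (sum1 (e 0)) (sum1 (fun i => (eta *: (delta_mx 0 k : 'rV[R]_n)) 0 i)) !mxE !eqxx mulr1.
by move: (\sum_i _) => z; clear -eta0 etae; nra.
Qed.

Lemma gap_herm (R : realType) n (phi : R -> R) (P0 P Q : 'M[R[i]]_n) (s a c : 'rV[R]_n) :
  (gap phi P0 P Q s a c)^t* = gap phi P0 P Q s a c.
Proof.
have sub (X Y : 'M[R[i]]_n) : (X - Y)^t* = X^t* - Y^t* by rewrite linearB /= map_mxB.
by rewrite /gap !sub !udiag_herm.
Qed.

(** Minimality in [P] and in [Q] makes E commute with both orbit terms, hence with phi(S), their sum
    plus E. Injectivity of [phi] carries this over to the arguments, so E can be diagonalized
    jointly with each of them without changing the gap of any function. *)
Lemma gap_min_ineq (R : realType) n (phi w : R -> R) (K M : R) (P0 P Q : 'M[R[i]]_n)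
    (s a b c : 'rV[R]_n) :
  supergradients_wrt K phi w -> phi 0 = 0 -> w 0 = 0 ->
  (forall x y, 0 <= x -> x < y -> phi x < phi y) ->
  (forall x y, 0 <= x -> x <= y -> phi y - phi x <= M * (y - x)) ->
  P0 \is unitarymx -> (forall j, 0 <= s 0 j) -> (forall j, 0 <= a 0 j) ->
  gap_minimizer phi P0 P Q s a b c ->
  frob (gap phi P0 P Q s a c) (gap w P0 P Q s a c) <=
    4 * K * frob (gap phi P0 P Q s a c) (gap phi P0 P Q s a c).
Proof.
move=> H phi0 w0 mono lip P0U s0 a0 cmin; have [[PU QU c0] opt] := cmin.
have c00 j : 0 <= c 0 j by case/andP: (c0 j).
have phi_ge0 t : 0 <= t -> 0 <= phi t.
  by rewrite le_eqVlt => /orP[/eqP <-|t0]; rewrite ?phi0 // -phi0 ltW // mono.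
have phi_inj (d : 'rV[R]_n) : (forall j, 0 <= d 0 j) ->
    forall i j, phi (d 0 i) = phi (d 0 j) -> d 0 i = d 0 j.
  move=> d0 i j pe; apply/eqP; rewrite eq_le; apply/andP; split;
    by rewrite leNgt; apply/negP => /mono; rewrite pe ltxx => /(_ (d0 _)).
set E := gap phi P0 P Q s a c in opt *.
have EH : E^t* = E by apply: gap_herm.
pose XP := udiag P0 (map_mx phi s) - udiag Q (map_mx phi c).
pose XQ := udiag P0 (map_mx phi s) - udiag P (map_mx phi a).
have subH (X Y : 'M[R[i]]_n) : X^t* = X -> Y^t* = Y -> (X - Y)^t* = X - Y.
  by move=> XH YH; rewrite linearB /= map_mxB XH YH.
have EP : XP - udiag P (map_mx phi a) = E by rewrite /XP /E /gap addrAC.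
have commP : E *m udiag P (map_mx phi a) = udiag P (map_mx phi a) *m E.
  rewrite -EP; apply: comm_transfer => //; first by apply: subH; apply: udiag_herm.
  move=> P' P'U; have := opt P' Q c (And3 P'U QU c0).
  by rewrite EP {1 2}/gap addrAC [in X in _ <= _ X]addrAC.
have commQ : E *m udiag Q (map_mx phi c) = udiag Q (map_mx phi c) *m E.
  apply: (@comm_transfer _ _ phi XQ) => //; first by apply: subH; apply: udiag_herm.
  by move=> Q' Q'U; exact: opt P Q' c (And3 PU Q'U c0).
have TE : udiag P0 (map_mx phi s) = udiag P (map_mx phi a) + udiag Q (map_mx phi c) + E.
  have -> : E = udiag P0 (map_mx phi s) - (udiag P (map_mx phi a) + udiag Q (map_mx phi c)).
    by rewrite /E /gap opprD addrA.
  by rewrite addrC subrK.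
have comm0 : E *m udiag P0 (map_mx phi s) = udiag P0 (map_mx phi s) *m E.
  have comm3 (X Y F : 'M[R[i]]_n) : F *m X = X *m F -> F *m Y = Y *m F ->
      F *m (X + Y + F) = (X + Y + F) *m F.
    by move=> FX FY; rewrite 2!mulmxDl 2!mulmxDr FX FY.
  by rewrite TE; exact: comm3.
have [P1 [eA [P1U P1a P1E]]] := codiag EH PU (comm_udiag_inj PU (phi_inj a a0) commP).
have [Q1 [eB [Q1U Q1c Q1E]]] := codiag EH QU (comm_udiag_inj QU (phi_inj c c00) commQ).
have [P2 [eS [P2U P2s P2E]]] := codiag EH P0U (comm_udiag_inj P0U (phi_inj s s0) comm0).
have gapE g : gap g P0 P Q s a c = gap g P2 P1 Q1 s a c.
  exact: (eq_addr_sub (udiag_map_eq g P0U P2U (esym P2s))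
    (udiag_map_eq g PU P1U (esym P1a)) (udiag_map_eq g QU Q1U (esym Q1c))).
have EQ1 : gap phi P0 P Q1 s a c = E.
  exact: (eq_addr_sub erefl erefl (udiag_map_eq phi Q1U QU Q1c)).
(* The sign condition is about the eigenvalues of E in the basis [Q1], so minimality is needed for
   [Q1] in place of [Q]. *)
have cmin1 : gap_minimizer phi P0 P Q1 s a b c.
  by apply: conj (And3 PU Q1U c0) _ => P' Q' c' f; rewrite EQ1; exact: opt.
rewrite gapE; apply: (matrix_trace_ineq H phi0 w0 phi_ge0 P2U P1U Q1U s0 a0 c00 P2E P1E Q1E).
  apply: etrans (udiag_map_eq phi P2U P0U P2s) (etrans TE _).
  exact: (eq_addr2 _ (udiag_map_eq phi PU P1U (esym P1a)) (udiag_map_eq phi QU Q1U (esym Q1c))).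
move=> k; apply: gap_min_psd mono lip cmin1 _.
by rewrite Q1E EQ1.
Qed.

(** * The linear path from the identity to [g] *)

Definition lin_path (R : realType) (g : R -> R) (t : R) : R -> R := fun x => (1 - t) * x + t * g x.

(** Slopes in [0, L] encode concavity, monotonicity and the Lipschitz bound on the half-line at
    once. *)
Definition has_supergradients (R : realType) (L : R) (g : R -> R) :=
  forall a, 0 <= a -> exists2 k, 0 <= k <= L &
    forall x, 0 <= x -> g x <= g a + k * (x - a).

(** A slope [k] of [g] gives [lin_path g t] the slope m = 1 - t + t k >= eta and g - id the slope k
    - 1, so the candidate is (k - 1) / m. The defect in the inequality is that of [g] divided by
    [m]. *)
Lemma supergradients_wrt_path (R : realType) (g : R -> R) (L t eta : R) :
  has_supergradients L g -> g 0 = 0 -> 0 < eta -> 0 <= t -> t <= 1 - eta ->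
  supergradients_wrt ((L + 1) / eta) (lin_path g t) (fun x => g x - x).
Proof.
move=> H g0 eta0 t0 t1 a a0; have [k /andP[k0 kL] Hk] := H a a0.
pose m := (1 - t) + t * k.
have meta : eta <= m by rewrite /m; nra.
have m0 : 0 < m by lra.
exists ((k - 1) / m).
  rewrite normrM normfV (gtr0_norm m0) ler_pdivrMr // mulrAC ler_pdivlMr //.
  have : `|k - 1| <= L + 1 by rewrite ler_norml; lra.
  have := normr_ge0 (k - 1); nra.
move=> x x0; rewrite /lin_path -subr_ge0.
have -> : g a - a + (k - 1) / m * ((1 - t) * x + t * g x - ((1 - t) * a + t * g a)) - (g x - x) =
   (g a + k * (x - a) - g x) / m by rewrite /m; field; rewrite /m in m0; lra.
by apply: divr_ge0; [have := Hk x x0; lra|exact: ltW].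
Qed.

Lemma supergradients_mono (R : realType) (g : R -> R) (L x y : R) :
  has_supergradients L g -> 0 <= x -> x <= y -> g x <= g y.
Proof.
move=> H x0 xy; have [k /andP[k0 _] /(_ x x0)] := H y (le_trans x0 xy); nra.
Qed.

Lemma supergradients_lip (R : realType) (g : R -> R) (L x y : R) :
  has_supergradients L g -> 0 <= x -> x <= y -> g y - g x <= L * (y - x).
Proof.
move=> H x0 xy; have [k /andP[k0 kL] /(_ y (le_trans x0 xy))] := H x x0; nra.
Qed.

Lemma addr_sub_lin (R : pzRingType) (V : lmodType R) (h : R) (T A X T' A' X' : V) :
  T + h *: T' - (A + h *: A') - (X + h *: X') = T - A - X + h *: (T' - A' - X').
Proof. by rewrite !scalerBr !opprD (addrACA T) (addrACA (T - A)). Qed.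

Lemma udiag_lin (R : realType) n (f w : R -> R) (h : R) (P : 'M[R[i]]_n) (d : 'rV[R]_n) :
  udiag P (map_mx (fun x => f x + h * w x) d) =
  udiag P (map_mx f d) + h%:C *: udiag P (map_mx w d).
Proof.
by rewrite -udiagZ -udiagD; congr udiag; apply/rowP => i; rewrite !mxE.
Qed.

Lemma gap_lin (R : realType) n (f w : R -> R) (h : R) (P0 P Q : 'M[R[i]]_n) (s a c : 'rV[R]_n) :
  gap (fun x => f x + h * w x) P0 P Q s a c =
  gap f P0 P Q s a c + h%:C *: gap w P0 P Q s a c.
Proof.
exact: etrans (eq_addr_sub (udiag_lin f w h P0 s) (udiag_lin f w h P a)
  (udiag_lin f w h Q c)) (addr_sub_lin _ _ _ _ _ _ _).
Qed.

Lemma frob_square_sub (R : realType) n (X Y : 'M[R[i]]_n) :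
  frob (X - Y) (X - Y) = frob X X - 2 * frob X Y + frob Y Y.
Proof. by rewrite frobBl [frob X (X - Y)]frobBr [frob Y (X - Y)]frobBr (frobC Y X); ring. Qed.

(** The right side minus the left side is |X + Y|^2 + |X + Z|^2 + |Y - Z|^2. *)
Lemma frob_sub3 (R : realType) n (X Y Z : 'M[R[i]]_n) :
  frob (X - Y - Z) (X - Y - Z) <= 3 * (frob X X + frob Y Y + frob Z Z).
Proof.
have := frob_ge0 (X + Y); have := frob_ge0 (X + Z); have := frob_ge0 (Y - Z).
rewrite (frob_square_sub (X - Y)) !frob_square_sub !frob_square_add [frob (X - Y) Z]frobBl.
by move: (frob X X) (frob Y Y) (frob Z Z) (frob X Y) (frob X Z) (frob Y Z) => *; lra.
Qed.

(** The bound is in terms of a separate row [e] so that, for C, it can be taken from the cap [b],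
    uniformly over feasible points. *)
Lemma frob_udiag_bound (R : realType) n (w : R -> R) (M : R) (P : 'M[R[i]]_n) (d e : 'rV[R]_n) :
  P \is unitarymx -> (forall i, `|w (d 0 i)| <= M * e 0 i) ->
  frob (udiag P (map_mx w d)) (udiag P (map_mx w d)) <= M ^+ 2 * \sum_i e 0 i ^+ 2.
Proof.
move=> PU we; rewrite frob_udiag // mulr_sumr; apply: ler_sum => i _.
rewrite !mxE -expr2 -exprMn -real_normK ?num_real //.
by rewrite lerXn2r ?nnegrE //; apply: le_trans (we i).
Qed.

Lemma frob_step (R : realType) n (K C h : R) (E W : 'M[R[i]]_n) :
  0 <= h -> frob E W <= K * frob E E -> frob W W <= C ->
  frob (E + h%:C *: W) (E + h%:C *: W) <= (1 + 2 * K * h) * frob E E + C * h ^+ 2.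
Proof.
move=> h0; rewrite frob_square_add [frob E (_ *: _)]frobZr frobZl frobZr.
move: (frob E W) (frob E E) (frob W W) => x y z xy zC.
have : h * (K * y - x) >= 0 by apply: mulr_ge0; lra.
have : h ^+ 2 * (C - z) >= 0 by apply: mulr_ge0; [exact: sqr_ge0|lra].
by rewrite !expr2; lra.
Qed.

(** * Existence of minimizers *)

From mathcomp Require Import topology normedtype sequences derive exp.

Import numFieldNormedType.Exports.
Local Open Scope classical_set_scope.

(** Continuity is stated on the two real parts, so that no topology on [R[i]] enters. *)
Definition continuous_cpx (R : realType) (T : topologicalType) (g : T -> R[i]) :=
  continuous (fun p => complex.Re (g p)) /\ continuous (fun p => complex.Im (g p)).

Lemma continuous_cpxD (R : realType) (T : topologicalType) (g h : T -> R[i]) :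
  continuous_cpx g -> continuous_cpx h -> continuous_cpx (fun p => g p + h p).
Proof.
move=> [g1 g2] [h1 h2]; split.
  rewrite (_ : (fun p => _) = (fun p => complex.Re (g p) + complex.Re (h p))); last first.
    by apply/funext => p; case: (g p) => a b; case: (h p).
  by move=> p; apply: cvgD; [exact: g1|exact: h1].
rewrite (_ : (fun p => _) = (fun p => complex.Im (g p) + complex.Im (h p))); last first.
  by apply/funext => p; case: (g p) => a b; case: (h p).
by move=> p; apply: cvgD; [exact: g2|exact: h2].
Qed.

Lemma continuous_cpxM (R : realType) (T : topologicalType) (g h : T -> R[i]) :
  continuous_cpx g -> continuous_cpx h -> continuous_cpx (fun p => g p * h p).
Proof.
move=> [g1 g2] [h1 h2]; split.
  rewrite (_ : (fun p => _) = (fun p => complex.Re (g p) * complex.Re (h p) -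
    complex.Im (g p) * complex.Im (h p))); last first.
    by apply/funext => p; case: (g p) => a b; case: (h p).
  by move=> p; apply: cvgB; apply: cvgM; do ?[exact: g1|exact: h1|exact: g2|exact: h2].
rewrite (_ : (fun p => _) = (fun p => complex.Re (g p) * complex.Im (h p) +
    complex.Im (g p) * complex.Re (h p))); last first.
  by apply/funext => p; case: (g p) => a b; case: (h p).
by move=> p; apply: cvgD; apply: cvgM; do ?[exact: g1|exact: h1|exact: g2|exact: h2].
Qed.

Lemma continuous_cpx_cst (R : realType) (T : topologicalType) (z : R[i]) : continuous_cpx (fun _ : T => z).
Proof. by split=> p; apply: cst_continuous. Qed.

Lemma continuous_cpxC (R : realType) (T : topologicalType) (g : T -> R[i]) :
  continuous_cpx g -> continuous_cpx (fun p => ((g p)^*)%R).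
Proof.
move=> [g1 g2]; split.
  by rewrite (_ : (fun p => _) = (fun p => complex.Re (g p))) //; apply/funext => p; case: (g p).
rewrite (_ : (fun p => _) = (fun p => - complex.Im (g p))); last first.
  by apply/funext => p; case: (g p).
by move=> p; apply: continuousN; exact: g2.
Qed.

Lemma continuous_cpx_sum (R : realType) (T : topologicalType) (I : finType) (g : I -> T -> R[i]) :
  (forall i, continuous_cpx (g i)) -> continuous_cpx (fun p => \sum_i g i p).
Proof.
move=> cg; elim: (index_enum I) => [|i r IH].
  by rewrite (_ : (fun p => _) = fun=> 0); [exact: continuous_cpx_cst|apply/funext => p; rewrite big_nil].
rewrite (_ : (fun p => _) = fun p => g i p + \sum_(j <- r) g j p); first exact: continuous_cpxD.
by apply/funext => p; rewrite big_cons.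
Qed.

Definition continuous_mx (R : realType) (T : topologicalType) m n (M : T -> 'M[R[i]]_(m, n)) :=
  forall i j, continuous_cpx (fun p => M p i j).

Lemma continuous_mxM (R : realType) (T : topologicalType) m n k (M : T -> 'M[R[i]]_(m, n))
    (N : T -> 'M[R[i]]_(n, k)) : continuous_mx M -> continuous_mx N -> continuous_mx (fun p => M p *m N p).
Proof.
move=> cM cN i j; rewrite (_ : (fun p => _) = fun p => \sum_l M p i l * N p l j).
  by apply: continuous_cpx_sum => l; apply: continuous_cpxM.
by apply/funext => p; rewrite mxE.
Qed.

Lemma continuous_mxB (R : realType) (T : topologicalType) m n (M N : T -> 'M[R[i]]_(m, n)) :
  continuous_mx M -> continuous_mx N -> continuous_mx (fun p => M p - N p).
Proof.
move=> cM cN i j; rewrite (_ : (fun p => _) = fun p => M p i j + (-1) * N p i j).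
  by apply: continuous_cpxD => //; apply: continuous_cpxM => //; exact: continuous_cpx_cst.
by apply/funext => p; rewrite !mxE mulN1r.
Qed.

Lemma continuous_mxC (R : realType) (T : topologicalType) m n (M : T -> 'M[R[i]]_(m, n)) :
  continuous_mx M -> continuous_mx (fun p => (M p)^t*).
Proof.
move=> cM i j; rewrite (_ : (fun p => _) = fun p => ((M p j i)^*)%R); first exact: continuous_cpxC.
by apply/funext => p; rewrite !mxE.
Qed.

Lemma continuous_mx_cst (R : realType) (T : topologicalType) m n (A : 'M[R[i]]_(m, n)) :
  continuous_mx (fun _ : T => A).
Proof. by move=> i j; exact: continuous_cpx_cst. Qed.

Lemma continuous_mx_udiag (R : realType) (T : topologicalType) n (M : T -> 'M[R[i]]_n)
    (d : T -> 'rV[R]_n) :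
  continuous_mx M -> (forall k, continuous (fun p => d p 0 k)) -> continuous_mx (fun p => udiag (M p) (d p)).
Proof.
move=> cM cd; apply: continuous_mxM => //; apply: continuous_mxM; first exact: continuous_mxC.
move=> i j; have [->|ij] := eqVneq i j.
  rewrite (_ : (fun p => _) = fun p => (d p 0 j)%:C).
    by split => //= p; exact: cst_continuous.
  by apply/funext => p; rewrite !mxE eqxx.
rewrite (_ : (fun p => _) = fun=> 0); first exact: continuous_cpx_cst.
by apply/funext => p; rewrite !mxE (negPf ij).
Qed.

Lemma frob_continuous (R : realType) (T : topologicalType) n (M : T -> 'M[R[i]]_n) :
  continuous_mx M -> continuous (fun p => frob (M p) (M p)).
Proof.
move=> cM; suff [] : continuous_cpx (fun p => \tr (M p *m (M p)^t*)) by [].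
by apply: continuous_cpx_sum => i; apply: continuous_mxM => //; exact: continuous_mxC.
Qed.

(** Presents unitarity as the zero set of a continuous function, hence as a closed condition. *)
Lemma unitary_frob0 (R : realType) n (M : 'M[R[i]]_n) :
  (M \is unitarymx) <-> frob (M *m M^t* - 1%:M) (M *m M^t* - 1%:M) = 0.
Proof.
split=> [/unitarymxP ->|/frob_eq0/eqP]; first by rewrite subrr /frob mul0mx linear0.
by rewrite subr_eq0 => /eqP/unitarymxP.
Qed.

Lemma unitary_entry (R : realType) n (M : 'M[R[i]]_n) i j : M \is unitarymx ->
  -1 <= complex.Re (M i j) <= 1 /\ -1 <= complex.Im (M i j) <= 1.
Proof.
move=> MU; have I1 : (1%:M : 'M[R[i]]_n) \is unitarymx.
  by apply/unitarymxP; rewrite trmx1 map_mx1 mulmx1.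
have := unitary_row_sum i MU I1; rewrite trmx1 map_mx1 mulmx1 (bigD1 j) //=.
have : 0 <= \sum_(k | k != j) sqnormc (M i k) by apply: sumr_ge0 => k _; exact: sqnormc_ge0.
rewrite {2}/sqnormc; move: (complex.Re _) (complex.Im _) (\sum_(k | _) _) => x y z.
by split; apply/andP; split; nra.
Qed.

Lemma ex_gap_minimizer (R : realType) n (phi : R -> R) (P0 : 'M[R[i]]_n) (s a b : 'rV[R]_n) :
  continuous phi -> (forall k, 0 <= b 0 k) ->
  exists P Q c, gap_minimizer phi P0 P Q s a b c.
Proof.
move=> cphi b0; pose F P Q c := frob (gap phi P0 P Q s a c) (gap phi P0 P Q s a c).
(* Triples (P, Q, c) become points of a finite power of [R], where Tychonoff applies. The first
   boolean selects P or Q, the second the real or imaginary part; [inr] indexes [c]. *)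
pose I : eqType := ((bool * bool * ('I_n * 'I_n)) + 'I_n)%type.
pose T := prod_topology (fun _ : I => R).
pose mx (h : bool) (p : T) : 'M[R[i]]_n :=
  \matrix_(i, j) (p (inl (h, false, (i, j))) +i* p (inl (h, true, (i, j)))).
pose cc (p : T) : 'rV[R]_n := \row_k p (inr k).
have cmx h : continuous_mx (mx h).
  move=> i j; split.
    rewrite (_ : (fun p => _) = fun p : T => p (inl (h, false, (i, j)))).
      exact: (@proj_continuous I (fun=> R) (inl (h, false, (i, j)))).
    by apply/funext => p; rewrite mxE.
  rewrite (_ : (fun p => _) = fun p : T => p (inl (h, true, (i, j)))).
    exact: (@proj_continuous I (fun=> R) (inl (h, true, (i, j)))).
  by apply/funext => p; rewrite mxE.
pose G p := F (mx false p) (mx true p) (cc p).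
have cG : continuous G.
  apply: frob_continuous; apply: continuous_mxB; first apply: continuous_mxB.
  - exact: continuous_mx_cst.
  - by apply: continuous_mx_udiag => // k p; exact: cst_continuous.
  apply: continuous_mx_udiag => // k.
  rewrite (_ : (fun p => _) = fun p : T => phi (p (inr k))).
    move=> p; apply: (@continuous_comp _ _ _ (fun p : T => p (inr k)) phi); last exact: cphi.
    exact: (@proj_continuous I (fun=> R) (inr k)).
  by apply/funext => p; rewrite !mxE.
pose box : I -> set R := fun i => match i with inl _ => `[-1, 1] | inr k => `[0, b 0 k] end.
pose uset h := [set p : T | mx h p \is unitarymx].
pose A := [set p : T | forall i, box i (p i)] `&` uset false `&` uset true.
have cu h : closed (uset h).
  pose u (p : T) := frob (mx h p *m (mx h p)^t* - 1%:M) (mx h p *m (mx h p)^t* - 1%:M).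
  have -> : uset h = u @^-1` [set 0].
    by apply/seteqP; split=> p; [exact: (unitary_frob0 _).1|exact: (unitary_frob0 _).2].
  apply: preimage_closed; last exact: closed_eq.
  move=> p _; apply: (@frob_continuous R T n (fun p => mx h p *m (mx h p)^t* - 1%:M)).
  apply: continuous_mxB; last exact: continuous_mx_cst.
  by apply: continuous_mxM => //; exact: continuous_mxC.
have cA : compact A.
  apply: compact_closedI => //; apply: compact_closedI => //.
  apply: (@tychonoff I (fun=> R) box) => -[q|k]; exact: segment_compact.
pose code P Q (c : 'rV[R]_n) : T := fun i => match i with
  | inl (h, g, (i, j)) => let M : 'M[R[i]]_n := if h then Q else P in
      if g then complex.Im (M i j) else complex.Re (M i j)
  | inr k => c 0 k end.
have codeP P Q c : mx false (code P Q c) = P.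
  by apply/matrixP => i j; rewrite mxE /=; case: (P i j).
have codeQ P Q c : mx true (code P Q c) = Q.
  by apply/matrixP => i j; rewrite mxE /=; case: (Q i j).
have codec P Q c : cc (code P Q c) = c.
  by apply/rowP => i; rewrite mxE.
have codeA P Q (c : 'rV[R]_n) : P \is unitarymx -> Q \is unitarymx ->
    (forall k, 0 <= c 0 k <= b 0 k) -> A (code P Q c).
  move=> PU QU c0; have uP : uset false (code P Q c) := eq_ind_r (fun M => M \is unitarymx) PU (codeP P Q c).
  have uQ : uset true (code P Q c) := eq_ind_r (fun M => M \is unitarymx) QU (codeQ P Q c).
  suff bx i : box i (code P Q c i) by exact: conj (conj bx uP) uQ.
  case: i => [[[h g] [i j]]|k] /=; rewrite in_itv /=; last exact: c0.
  have [Pr Pi] := unitary_entry i j PU; have [Qr Qi] := unitary_entry i j QU.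
  by case: h; case: g.
have I1 : (1%:M : 'M[R[i]]_n) \is unitarymx.
  by apply/unitarymxP; rewrite trmx1 map_mx1 mulmx1.
have [|p] := compact_EVT_min _ cA (continuous_subspaceT cG).
  exists (code 1%:M 1%:M 0); apply: codeA => // k; by rewrite mxE lexx b0.
move=> /set_mem [[pbox pP] pQ] pmin.
have bnd k : 0 <= cc p 0 k <= b 0 k by have := pbox (inr k); rewrite /= in_itv /= mxE.
exists (mx false p), (mx true p), (cc p); apply: conj (And3 pP pQ bnd) _.
move=> P Q c [PU QU c0]; have := pmin _ (mem_set (codeA P Q c PU QU c0)).
by rewrite /G codeP codeQ codec.
Qed.

(** * Deformation of the identity *)

Lemma addr_sub_eq0 (V : zmodType) (T A X : V) : T - A - X = 0 -> T = A + X.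
Proof. by move/subr0_eq <-; rewrite addrC subrK. Qed.

Section Path.
Context (R : realType) (n : nat) (g : R -> R) (L : R) (P0 : 'M[R[i]]_n) (s a b : 'rV[R]_n).
Context (g_sup : has_supergradients L g) (g00 : g 0 = 0) (g_cont : continuous g).
Context (P0U : P0 \is unitarymx) (s0 : forall i, 0 <= s 0 i).
Context (a0 : forall i, 0 <= a 0 i) (b0 : forall i, 0 <= b 0 i).

Let w x := g x - x.
Let C := 3 * ((L + 1) ^+ 2 * \sum_i s 0 i ^+ 2 + (L + 1) ^+ 2 * \sum_i a 0 i ^+ 2
  + (L + 1) ^+ 2 * \sum_i b 0 i ^+ 2).

Lemma lip_const_ge0 : 0 <= L.
Proof. by have [k /andP[k0 kL] _] := g_sup (lexx 0); exact: le_trans kL. Qed.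

Lemma drift_le x y : 0 <= x -> x <= y -> `|w x| <= (L + 1) * y.
Proof.
move=> x0 xy; have L0 := lip_const_ge0; rewrite /w.
have := supergradients_lip g_sup (lexx 0) x0; rewrite g00 !subr0 => gL.
have := supergradients_mono g_sup (lexx 0) x0; rewrite g00 => g0.
by rewrite ler_norml; apply/andP; split; nra.
Qed.

Lemma gap_drift_le P Q c : feasible P Q b c ->
  frob (gap w P0 P Q s a c) (gap w P0 P Q s a c) <= C.
Proof.
move=> [PU QU c0]; apply: le_trans (frob_sub3 _ _ _) _; rewrite /C ler_pM2l //.
apply: lerD; first apply: lerD; apply: frob_udiag_bound => // i; apply: drift_le => //;
  by case/andP: (c0 i).
Qed.

Lemma drift_bound_ge0 : 0 <= C.
Proof.
have S (d : 'rV[R]_n) : 0 <= (L + 1) ^+ 2 * \sum_i d 0 i ^+ 2.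
  by apply: mulr_ge0; [|apply: sumr_ge0 => i _]; exact: sqr_ge0.
by apply: mulr_ge0 => //; apply: addr_ge0 => //; exact: addr_ge0.
Qed.

Lemma lin_path0 t : lin_path g t 0 = 0.
Proof. by rewrite /lin_path g00 !mulr0 addr0. Qed.

Lemma lin_path_mono t x y : 0 <= t < 1 -> 0 <= x -> x < y -> lin_path g t x < lin_path g t y.
Proof.
move=> /andP[t0 t1] x0 xy; rewrite /lin_path.
have := supergradients_mono g_sup x0 (ltW xy); nra.
Qed.

Lemma lin_path_lip t x y : 0 <= t <= 1 -> 0 <= x -> x <= y ->
  lin_path g t y - lin_path g t x <= (L + 1) * (y - x).
Proof.
move=> /andP[t0 t1] x0 xy; rewrite /lin_path.
have lipg := supergradients_lip g_sup x0 xy; have L0 := lip_const_ge0.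
have : t * (g y - g x) <= t * (L * (y - x)) by exact: ler_wpM2l.
have : t * (L * (y - x)) <= 1 * (L * (y - x)).
  by apply: ler_wpM2r => //; apply: mulr_ge0 => //; lra.
have : 0 <= t * (y - x) by apply: mulr_ge0 => //; lra.
lra.
Qed.

Lemma lin_path_cont t : continuous (lin_path g t).
Proof.
move=> x; apply: cvgD; apply: cvgM; [exact: cvg_cst|exact: cvg_id|exact: cvg_cst|exact: g_cont].
Qed.

Lemma lin_path_step t h P Q c :
  gap (lin_path g (t + h)) P0 P Q s a c =
  gap (lin_path g t) P0 P Q s a c + h%:C *: gap w P0 P Q s a c.
Proof.
have -> : lin_path g (t + h) = fun x => lin_path g t x + h * w x.
  by apply/funext => x; rewrite /lin_path /w; ring.
exact: gap_lin.
Qed.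

(** The value m(t) as a relation, so that a minimizer comes with it. *)
Definition least_gap t r := exists P Q c,
  gap_minimizer (lin_path g t) P0 P Q s a b c /\
  r = frob (gap (lin_path g t) P0 P Q s a c) (gap (lin_path g t) P0 P Q s a c).

Lemma ex_least_gap t : exists r, least_gap t r.
Proof.
have [P [Q [c H]]] := ex_gap_minimizer P0 s a (@lin_path_cont t) b0.
by eexists; exists P, Q, c; split; first exact: H.
Qed.

Lemma least_gap_ge0 t r : least_gap t r -> 0 <= r.
Proof. by move=> [P [Q [c [_ ->]]]]; exact: frob_ge0. Qed.

Lemma least_gap_le t r P Q c : least_gap t r -> feasible P Q b c ->
  r <= frob (gap (lin_path g t) P0 P Q s a c) (gap (lin_path g t) P0 P Q s a c).
Proof. by move=> [P' [Q' [c' [[_ H] ->]]]]; exact: H. Qed.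

(** The minimizer at t stays feasible at t + h, where its gap is E + h W. The 8 is the 4 of
    [gap_min_ineq] times the 2 of the cross term 2 h <E, W>. *)
Lemma least_gap_step eta t h r r' : 0 < eta -> 0 <= t -> t <= 1 - eta -> 0 <= h ->
  least_gap t r -> least_gap (t + h) r' ->
  r' <= (1 + 8 * ((L + 1) / eta) * h) * r + C * h ^+ 2.
Proof.
move=> eta0 t0 t1 h0 [P [Q [c [cmin ->]]]] v'; have [f _] := cmin.
apply: le_trans (least_gap_le v' f) _; rewrite lin_path_step.
have -> : 8 * ((L + 1) / eta) * h = 2 * (4 * ((L + 1) / eta)) * h by ring.
apply: frob_step => //; last exact: gap_drift_le.
have t01 : t < 1 by apply: le_lt_trans t1 _; rewrite ltrBlDr ltrDl.
apply: (@gap_min_ineq _ _ _ _ _ (L + 1) _ _ _ _ _ b) => //.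
- exact: supergradients_wrt_path.
- exact: lin_path0.
- by rewrite /w g00 subrr.
- by move=> x y; apply: lin_path_mono; rewrite t0.
by move=> x y; apply: lin_path_lip; rewrite t0 ltW.
Qed.

(** Discrete Gronwall: N steps of length h = (1 - eta) / N accumulate at most C h^2 N (1 + q h)^N,
    which is at most a constant divided by N. *)
Lemma least_gap_lt1 eta r : 0 < eta -> eta <= 1 -> least_gap 0 0 -> least_gap (1 - eta) r -> r = 0.
Proof.
move=> eta0 eta1 v0 v; apply/eqP; rewrite eq_le (least_gap_ge0 v) andbT.
pose q := 8 * ((L + 1) / eta).
have q0 : 0 <= q by apply: mulr_ge0 => //; apply: divr_ge0; [have := lip_const_ge0|]; lra.
have main (N : nat) : (0 < N)%N -> r <= C * (1 - eta) ^+ 2 * expR (q * (1 - eta)) / N%:R.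
  move=> N0; have N0' : (0 : R) < N%:R by rewrite ltr0n.
  pose h := (1 - eta) / N%:R.
  have h0 : 0 <= h by apply: divr_ge0 => //; lra.
  have ind k r' : (k <= N)%N -> least_gap (k%:R * h) r' ->
      r' <= C * h ^+ 2 * k%:R * (1 + q * h) ^+ k.
    elim: k r' => [|k IH] r' kN.
      rewrite mul0r mulr0 mul0r; have [P [Q [c [[f _] E]]]] := v0.
      by move=> /least_gap_le/(_ f); rewrite -E.
    have [r1 v1] := ex_least_gap (k%:R * h).
    have r1le := IH _ (ltnW kN) v1.
    rewrite -natr1 mulrDl mul1r => v'.
    have := @least_gap_step eta (k%:R * h) h r1 r' eta0 _ _ h0 v1 v'.
    rewrite mulr_ge0 // => /(_ isT).
    have -> : k%:R * h <= 1 - eta.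
      rewrite /h mulrCA ler_piMr //; first lra.
      by rewrite ler_pdivrMr // mul1r ler_nat ltnW.
    move=> /(_ isT) H; apply: le_trans H _; rewrite -/q (exprS _ k).
    have : (1 + q * h) * r1 <= (1 + q * h) * (C * h ^+ 2 * k%:R * (1 + q * h) ^+ k).
      by apply: ler_wpM2l => //; apply: addr_ge0 => //; exact: mulr_ge0.
    have : 1 <= (1 + q * h) * (1 + q * h) ^+ k.
      by rewrite -exprS exprn_ege1 // lerDl mulr_ge0.
    have Ch0 : 0 <= C * h ^+ 2 by apply: mulr_ge0; [exact: drift_bound_ge0|exact: sqr_ge0].
    move=> /(ler_wpM2l Ch0).
    by move: (C * h ^+ 2) (k%:R : R) ((1 + q * h) ^+ k) => x y z; lra.
  have Nh : N%:R * h = 1 - eta by rewrite /h mulrC mulfVK // gt_eqF.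
  rewrite -Nh in v; apply: le_trans (ind N r (leqnn _) v) _.
  have -> : C * h ^+ 2 * N%:R * (1 + q * h) ^+ N =
     C * (1 - eta) ^+ 2 / N%:R * (1 + q * h) ^+ N.
    by congr (_ * _); rewrite -Nh; field; rewrite gt_eqF.
  rewrite [leRHS]mulrAC; apply: ler_wpM2l.
    by apply: divr_ge0 => //; apply: mulr_ge0; [exact: drift_bound_ge0|exact: sqr_ge0].
  have -> : q * (1 - eta) = N%:R * (q * h) by rewrite -Nh; ring.
  rewrite expRM_natl lerXn2r ?nnegrE ?expR_ge1Dx // ?expR_ge0 //.
  by apply: addr_ge0 => //; exact: mulr_ge0.
rewrite leNgt; apply/negP => r0.
set D := C * (1 - eta) ^+ 2 * expR (q * (1 - eta)) in main.
have [N HN] : exists N : nat, D / r < N%:R.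
  by exists (Num.bound `|D / r|); apply: le_lt_trans (ler_norm _) _; exact: archi_boundP.
have := main N.+1 isT; rewrite ler_pdivlMr // mulrC -ler_pdivlMr //.
by rewrite leNgt (lt_trans HN) // ltr_nat.
Qed.

(** At time 1 - eta the gap can be made 0; with that point frozen, the gap at time 1 is eta times
    the drift, of squared norm at most C eta^2. *)
Lemma least_gap1 r : least_gap 0 0 -> least_gap 1 r -> r = 0.
Proof.
move=> v0 v1; apply/eqP; rewrite eq_le (least_gap_ge0 v1) andbT.
have main eta : 0 < eta -> eta <= 1 -> r <= C * eta.
  move=> eta0 eta1; have [r' v] := ex_least_gap (1 - eta).
  have r'0 := least_gap_lt1 eta0 eta1 v0 v.
  have [P [Q [c [[f _]]]]] := v; rewrite r'0 => /esym/frob_eq0 E0.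
  apply: le_trans (least_gap_le v1 f) _; rewrite -[X in lin_path g X](subrK eta).
  rewrite lin_path_step E0 add0r frobZl frobZr mulrA mulrC.
  apply: (@le_trans _ _ (C * (eta * eta))).
    by apply: ler_wpM2r; [apply: mulr_ge0; exact: ltW|exact: gap_drift_le].
  by apply: ler_wpM2l; [exact: drift_bound_ge0|rewrite ler_piMr // ltW].
rewrite leNgt; apply/negP => r0; have C0 := drift_bound_ge0.
(* This choice of eta makes C eta at most r / 2. *)
have := main (Num.min 1 (r / (2 * (C + 1)))).
rewrite lt_min ltr01 ge_min lexx /= divr_gt0 //; last by lra.
move=> /(_ isT isT); apply/negP; rewrite -ltNge.
have : Num.min 1 (r / (2 * (C + 1))) <= r / (2 * (C + 1)) by rewrite ge_min lexx orbT.
rewrite ler_pdivlMr; last by lra.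
have : 0 <= Num.min 1 (r / (2 * (C + 1))).
  by rewrite le_min ler01 divr_ge0 //; lra.
by move: (Num.min _ _) => x; nra.
Qed.

(** At t = 0 the path is the identity, so the given decomposition of S is itself a point of zero
    gap. *)
Lemma lipschitz_case Pa Pb : Pa \is unitarymx -> Pb \is unitarymx ->
  udiag P0 s = udiag Pa a + udiag Pb b ->
  exists P Q c, feasible P Q b c /\
    udiag P0 (map_mx g s) = udiag P (map_mx g a) + udiag Q (map_mx g c).
Proof.
move=> PaU PbU sE.
have path0 d P : udiag P (map_mx (lin_path g 0) d) = udiag P d.
  by congr udiag; apply/rowP => i; rewrite mxE /lin_path subr0 mul1r mul0r addr0.
have path1 d P : udiag P (map_mx (lin_path g 1) d) = udiag P (map_mx g d).
  by congr udiag; apply/rowP => i; rewrite !mxE /lin_path subrr mul1r mul0r add0r.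
have bb k : 0 <= b 0 k <= b 0 k by rewrite b0 lexx.
have fb : feasible Pa Pb b b := And3 PaU PbU bb.
have v0 : least_gap 0 0.
  have g0 : gap (lin_path g 0) P0 Pa Pb s a b = 0.
    by rewrite /gap !path0 sE -addrA -opprD subrr.
  have r0 : frob (gap (lin_path g 0) P0 Pa Pb s a b) (gap (lin_path g 0) P0 Pa Pb s a b) = 0.
    by rewrite g0 /frob mul0mx linear0.
  exists Pa, Pb, b; split=> //; split=> // P Q c _.
  by rewrite r0; exact: frob_ge0.
have [r v1] := ex_least_gap 1; have r0 := least_gap1 v0 v1.
have [P [Q [c [[f _]]]]] := v1; rewrite r0 => /esym/frob_eq0.
by rewrite /gap !path1 => /addr_sub_eq0 E; exists P, Q, c.
Qed.
End Path.

(** * Concave functions *)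

Definition concave_on_nneg (R : realType) (h : R -> R) :=
  forall x y t, 0 <= x -> 0 <= y -> 0 <= t <= 1 ->
    t * h x + (1 - t) * h y <= h (t * x + (1 - t) * y).

Lemma concave_slopes (R : realType) (h : R -> R) x a y :
  concave_on_nneg h -> 0 <= x -> x < a -> a < y ->
  (a - x) * (h y - h a) <= (y - a) * (h a - h x).
Proof.
move=> H x0 xa ay; have yx : 0 < y - x by lra.
have y0 : 0 <= y by lra.
have := H x y ((y - a) / (y - x)) x0 y0.
have -> : (y - a) / (y - x) * x + (1 - (y - a) / (y - x)) * y = a by field; lra.
have -> : (y - a) / (y - x) * h x + (1 - (y - a) / (y - x)) * h y =
  ((y - a) * h x + (a - x) * h y) / (y - x) by field; lra.
rewrite ler_pdivlMr // ler_pdivrMr // mul0r mul1r ler_pdivrMr //.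
have -> : (0 <= y - a) && (y - a <= y - x) by apply/andP; split; lra.
by move=> /(_ isT); lra.
Qed.

Lemma concave_nneg_mono (R : realType) (f : R -> R) x y :
  concave_on_nneg f -> (forall z, 0 <= z -> 0 <= f z) -> 0 <= x -> x <= y -> f x <= f y.
Proof.
move=> H f0 x0; rewrite le_eqVlt => /orP[/eqP -> //|xy].
rewrite leNgt; apply/negP => fyx; have y0 : 0 <= y by lra.
have fy := f0 y y0; have fx : 0 < f x by lra.
(* If f y < f x, write y = l x + (1 - l) z with z beyond y. Concavity and f z >= 0 give f y >= l f
   x, and [l] is chosen so that l f x is the midpoint of f x and f y, which exceeds f y. *)
pose l := (f x + f y) / (2 * f x).
have l0 : 0 <= l by apply: divr_ge0; lra.
have lE : l * f x = (f x + f y) / 2 by rewrite /l; field; lra.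
have l1 : l < 1 by rewrite ltr_pdivrMr; lra.
have z0 : 0 <= (y - l * x) / (1 - l) by apply: divr_ge0; nra.
have := H x ((y - l * x) / (1 - l)) l x0 z0.
rewrite l0 ltW // => /(_ isT).
have -> : l * x + (1 - l) * ((y - l * x) / (1 - l)) = y by field; lra.
have := f0 _ z0; nra.
Qed.

(** For a > 0 take the supremum of the chord slopes to the right of [a]. The chord slopes to its
    left bound it from above, and the chord from 0 has slope at most L. At 0 the slope L works by
    hypothesis. *)
Lemma concave_supergradients (R : realType) (h : R -> R) (L : R) :
  concave_on_nneg h -> (forall z, 0 <= z -> 0 <= h z) ->
  (forall z, 0 <= z -> h z <= L * z) -> has_supergradients L h.
Proof.
move=> H h0 hL; have h00 : h 0 = 0.
  by apply/eqP; rewrite eq_le h0 // andbT -[leRHS](mulr0 L) hL.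
have L0 : 0 <= L by have := hL 1 ler01; have := h0 1 ler01; lra.
move=> a; rewrite le_eqVlt => /orP[/eqP <-|a0].
  by exists L; [rewrite L0 lexx|move=> x x0; rewrite h00 add0r subr0; exact: hL].
pose D := [set (h y - h a) / (y - a) | y in [set y | a < y]].
have D1 : D ((h (a + 1) - h a) / (a + 1 - a)) by exists (a + 1) => //=; lra.
have D0 : D !=set0 by eexists; exact: D1.
have ub x : 0 <= x -> x < a -> ubound D ((h a - h x) / (a - x)).
  move=> x0 xa _ [y /= ay <-]; rewrite ler_pdivrMr ?subr_gt0 // mulrAC.
  rewrite ler_pdivlMr ?subr_gt0 //.
  by have := concave_slopes H x0 xa ay; lra.
have Dsup : has_sup D by split=> //; eexists; exact: (ub 0 (lexx _) a0).
have supge y : a < y -> h y - h a <= sup D * (y - a).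
  move=> ay; rewrite -ler_pdivrMr ?subr_gt0 //; apply: ub_le_sup; first by case: Dsup.
  by exists y.
have suple x : 0 <= x -> x < a -> sup D * (a - x) <= h a - h x.
  by move=> x0 xa; rewrite -ler_pdivlMr ?subr_gt0 //; apply: ge_sup => //; exact: ub.
exists (sup D).
  apply/andP; split.
    have : (h (a + 1) - h a) / (a + 1 - a) <= sup D by apply: ub_le_sup => //; case: Dsup.
    apply: le_trans; apply: divr_ge0; last by lra.
    by rewrite subr_ge0; apply: concave_nneg_mono => //; lra.
  have := suple 0 (lexx _) a0; rewrite h00 !subr0 => /le_trans/(_ (hL a (ltW a0))).
  by rewrite ler_pM2r.
move=> x x0; have [xa|ax|->] := ltgtP x a.
- by have := suple x x0 xa; lra.
- by have := supge x ax; lra.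
by rewrite subrr mulr0 addr0.
Qed.

Lemma supergradients_nneg_cont (R : realType) (h : R -> R) (L : R) :
  has_supergradients L h -> continuous (fun x : R => h (Num.max x 0) : R).
Proof.
move=> H; have L0 : 0 <= L by have [k /andP[k0 kL] _] := H 0 (lexx _); exact: le_trans kL.
have main (x y : R) : x <= y -> `|h (Num.max x 0) - h (Num.max y 0)| <= L * (y - x).
  move=> xy; have m0 : 0 <= Num.max x 0 by rewrite le_max lexx orbT.
  have mm : Num.max x 0 <= Num.max y 0 by rewrite ge_max le_max xy /= le_max lexx orbT.
  have := supergradients_lip H m0 mm; have := supergradients_mono H m0 mm.
  have : L * (Num.max y 0 - Num.max x 0) <= L * (y - x).
    by apply: ler_wpM2l => //; case: (leP x 0) => ?; case: (leP y 0) => ?; lra.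
  by rewrite ler_norml => *; apply/andP; split; lra.
move=> x; apply/cvgrPdist_le => e e0; apply/nbhs_ballP.
exists (e / (L + 1)) => /=; first by apply: divr_gt0; lra.
move=> y /= xy; rewrite /ball /= ltr_pdivlMr in xy; last by lra.
have le : L * `|x - y| <= e by have := normr_ge0 (x - y); nra.
apply: le_trans le; have [le|lt] := leP x y.
  by rewrite (distrC x y) (ger0_norm (x := y - x)) ?subr_ge0 // main.
by rewrite [X in X <= _]distrC (gtr0_norm (x := x - y)) ?subr_gt0 // main // ltW.
Qed.

(** [f] may jump or have infinite slope at 0; the cap L x removes both. The maxima extend the
    function by a constant to negative arguments, so that it is continuous on all of [R]. *)
Definition truncation (R : realType) (f : R -> R) (L x : R) : R :=
  Num.min (f (Num.max x 0) - f 0) (L * Num.max x 0).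

Lemma concave_min (R : realType) (f : R -> R) (L : R) :
  concave_on_nneg f -> concave_on_nneg (fun x => Num.min (f x - f 0) (L * x)).
Proof.
move=> H x y t x0 y0 t01; have Hf := H x y t x0 y0 t01; have [t0 t1] := andP t01.
rewrite le_min; apply/andP; split.
  apply: (@le_trans _ _ (t * (f x - f 0) + (1 - t) * (f y - f 0))); last by lra.
  by apply: lerD; apply: ler_wpM2l; rewrite ?subr_ge0 // ge_min lexx.
apply: (@le_trans _ _ (t * (L * x) + (1 - t) * (L * y))); last by lra.
by apply: lerD; apply: ler_wpM2l; rewrite ?subr_ge0 // ge_min lexx orbT.
Qed.

Lemma truncationP (R : realType) (f : R -> R) (L : R) :
  0 <= L -> (forall x, 0 <= x -> 0 <= f x) -> concave_on_nneg f ->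
  [/\ has_supergradients L (truncation f L), truncation f L 0 = 0,
     continuous (truncation f L) & forall x, 0 <= x -> truncation f L x <= f x - f 0].
Proof.
move=> L0 f0 H; pose h x := Num.min (f x - f 0) (L * x).
have hE x : 0 <= x -> truncation f L x = h x by move=> x0; rewrite /truncation /h max_l.
have hsup : has_supergradients L h.
  apply: concave_supergradients; first exact: concave_min.
    move=> z z0; rewrite le_min mulr_ge0 // subr_ge0 andbT.
    by apply: concave_nneg_mono.
  by move=> z z0; rewrite ge_min lexx orbT.
split.
- move=> a a0; have [k k0 Hk] := hsup a a0; exists k => // x x0.
  by rewrite !hE //; exact: Hk.
- by rewrite hE // /h subrr mulr0 minxx.
- exact: supergradients_nneg_cont hsup.
by move=> x x0; rewrite hE // ge_min lexx.
Qed.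

Lemma truncation_eq (R : realType) n (f : R -> R) (L : R) (d : 'rV[R]_n) :
  (forall i, 0 <= d 0 i) -> (forall i, (f (d 0 i) - f 0) / d 0 i <= L) ->
  map_mx f d = map_mx (truncation f L) d + const_mx (f 0).
Proof.
move=> d0 dL; apply/rowP => i; rewrite !mxE /truncation max_l // min_l ?subrK //.
(* At a zero eigenvalue the quotient says nothing, but both terms of the minimum vanish. *)
have [->|dn] := eqVneq (d 0 i) 0; first by rewrite subrr mulr0.
by rewrite -ler_pdivrMr // lt_def dn d0.
Qed.

Lemma udiag_const (R : realType) n (P : 'M[R[i]]_n) (r : R) :
  P \is unitarymx -> udiag P (const_mx r) = (r%:C)%:M.
Proof.
move=> PU; rewrite /udiag map_const_mx diag_const_mx mul_mx_scalar -scalemxAl.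
by rewrite unitary_mulC // scalemx1.
Qed.

Lemma psdmx_udiag (R : realType) n (P : 'M[R[i]]_n) (d : 'rV[R]_n) :
  (forall i, 0 <= d 0 i) -> psdmx (udiag P d).
Proof.
move=> d0; split.
  by apply/is_hermitianmxP; rewrite expr0 scale1r -[LHS]udiag_herm.
move=> u; rewrite udiag_quad lecR; apply: sumr_ge0 => i _.
by apply: mulr_ge0 => //; exact: sqnormc_ge0.
Qed.

Lemma psdmxP (R : realType) n (A : 'M[R[i]]_n) : psdmx A ->
  exists (P : 'M[R[i]]_n) (d : 'rV[R]_n), [/\ P \is unitarymx, forall i, 0 <= d 0 i & A = udiag P d].
Proof.
move=> [AH Apos]; pose P := spectralmx A; pose d := map_mx (@complex.Re R) (spectral_diag A).
have PU : P \is unitarymx by apply: spectral_unitarymx.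
have dE : spectral_diag A = map_mx (real_complex R) d.
  apply/rowP => i; rewrite !mxE.
  have /mxOverP/(_ 0 i) := hermitian_spectral_diag_real AH.
  by case: (spectral_diag A 0 i) => x y; rewrite complex_real => /eqP ->.
have AE : A = udiag P d.
  rewrite /udiag -dE -invmx_unitary //.
  exact: (orthomx_spectralP (hermitian_normalmx AH)).
exists P, d; split=> // i; have := Apos (P^t* *m col i 1%:M).
rewrite {1}AE udiag_quad mulmxA (unitarymxP PU) mul1mx lecR (bigD1 i) //= big1.
  by rewrite addr0 !mxE eqxx /sqnormc /= expr1n expr0n addr0 mulr1.
by move=> k ki; rewrite !mxE (negPf ki) /sqnormc /= expr0n addr0 mulr0.
Qed.

Lemma psdmxD (R : realType) n (A B : 'M[R[i]]_n) : psdmx A -> psdmx B -> psdmx (A + B).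
Proof.
move=> [AH A0] [BH B0]; split.
  move/is_hermitianmxP: AH; move/is_hermitianmxP: BH; rewrite expr0 !scale1r => BH AH.
  by apply/is_hermitianmxP; rewrite expr0 scale1r trmxC_add -AH -BH.
by move=> u; rewrite mulmxDr mulmxDl mxE addr_ge0.
Qed.

(** Q^* P carries the eigenbasis [P] to [Q]; this recovers the conjugating unitaries from the
    eigenbases. *)
Lemma conj_udiag (R : realType) n (P Q : 'M[R[i]]_n) (d : 'rV[R]_n) : P \is unitarymx ->
  (Q^t* *m P) *m udiag P d *m (Q^t* *m P)^t* = udiag Q d.
Proof.
move=> PU; have -> : udiag Q d = udiag (P *m (P^t* *m Q)) d.
  by rewrite mulmxA (unitarymxP PU) mul1mx.
by rewrite udiag_mulr (trmxC_mul (P^t*)) (trmxC_mul (Q^t*)) !trmxCK.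
Qed.

Theorem theorem4p2 (R : realType) (n : nat) (A B : 'M[R[i]]_n) (f : R -> R)
  (hA : psdmx A) (hB : psdmx B)
  (f_ge0 : forall x : R, 0 <= x -> 0 <= f x)
  (f_concave : concave_function [set x : R | 0 <= x]%classic f) :
  exists U V : 'M[R[i]]_n,
    [/\ U \is unitarymx,
        V \is unitarymx,
        loewner_le 0 (fun_calc f (A + B) - U *m fun_calc f A *m U ^t*) &
        loewner_le (fun_calc f (A + B) - U *m fun_calc f A *m U ^t*)
                   (V *m fun_calc f B *m V ^t*)].
Proof.
have fc : concave_on_nneg f.
  by move=> x y t x0 y0 t01; exact: ((concave_functionP _ _).1 f_concave).
have [Pa [a [PaU a0 AE]]] := psdmxP hA.
have [Pb [b [PbU b0 BE]]] := psdmxP hB.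
have [P0 [s [P0U s0 SE]]] := psdmxP (psdmxD hA hB).
pose slope (d : 'rV[R]_n) i : R := `|(f (d 0 i) - f 0) / d 0 i|.
(* Above every chord slope from 0 at the eigenvalues of A + B and A, where [g] has to equal f -
   f(0). For B the inequality g <= f - f(0) is enough. *)
pose L : R := \sum_i slope s i + \sum_i slope a i.
have slopes0 d : 0 <= \sum_i slope d i by apply: sumr_ge0 => i _; exact: normr_ge0.
have slope_le (d : 'rV[R]_n) i : (f (d 0 i) - f 0) / d 0 i <= \sum_i slope d i.
  apply: le_trans (ler_norm _) _; rewrite (bigD1 i) //= lerDl.
  by apply: sumr_ge0 => j _; exact: normr_ge0.
have sL i : (f (s 0 i) - f 0) / s 0 i <= L.
  by apply: le_trans (slope_le s i) _; rewrite lerDl.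
have aL i : (f (a 0 i) - f 0) / a 0 i <= L.
  by apply: le_trans (slope_le a i) _; rewrite lerDr.
have [gsup g0 gcont gf] := truncationP (addr_ge0 (slopes0 s) (slopes0 a)) f_ge0 fc.
rewrite -/L in gsup g0 gcont gf; set g := truncation f L in gsup g0 gcont gf.
have [P [Q [c [[PU QU c0] gE]]]] : exists P Q c, feasible P Q b c /\
    udiag P0 (map_mx g s) = udiag P (map_mx g a) + udiag Q (map_mx g c).
  apply: (lipschitz_case gsup g0 gcont P0U s0 a0 b0 PaU PbU).
  by rewrite -AE -BE -SE.
have c00 i : 0 <= c 0 i by case/andP: (c0 i).
have g_ge0 x : 0 <= x -> 0 <= g x.
  by move=> x0; rewrite -g0; exact: supergradients_mono gsup (lexx 0) x0.
have fS : fun_calc f (A + B) = udiag P0 (map_mx g s) + (f 0)%:C%:M.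
  rewrite [in LHS]SE fun_calc_udiag // (truncation_eq s0 sL).
  by rewrite (udiagD P0) (udiag_const _ P0U).
have fA : udiag P (map_mx f a) = udiag P (map_mx g a) + (f 0)%:C%:M.
  by rewrite (truncation_eq a0 aL) (udiagD P) (udiag_const _ PU).
have gap : fun_calc f (A + B) - (P^t* *m Pa) *m fun_calc f A *m (P^t* *m Pa)^t* =
    udiag Q (map_mx g c).
  rewrite fS [in LHS]AE fun_calc_udiag // conj_udiag // fA gE.
  (* The two scalar matrices f(0) cancel. *)
  by rewrite opprD addrACA subrr addr0 addrC addKr.
exists (P^t* *m Pa), (Q^t* *m Pb); split.
- exact: unitary_mul (unitary_trC PU) PaU.
- exact: unitary_mul (unitary_trC QU) PbU.
- rewrite gap /loewner_le subr0; apply: psdmx_udiag => i.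
  by rewrite mxE; exact: g_ge0.
have fB : (Q^t* *m Pb) *m fun_calc f B *m (Q^t* *m Pb)^t* = udiag Q (map_mx f b).
  by rewrite BE fun_calc_udiag // conj_udiag.
rewrite /loewner_le gap fB -(udiagB Q).
apply: psdmx_udiag => i; rewrite !mxE subr_ge0.
(* Eigenvalue by eigenvalue: g(c) <= f(c) - f(0) <= f(b) - f(0) <= f(b). *)
apply: le_trans (gf _ (c00 i)) _.
have : f (c 0 i) <= f (b 0 i) by apply: concave_nneg_mono => //; case/andP: (c0 i).
by have := f_ge0 0 (lexx 0); lra.
Qed.
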